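(* Let $d\ge3$ and let $K:\mathbb{S}^{d-1}\times\mathbb{S}^{d-1}\to\mathbb{C}$ be a Hermitian, axially symmetric kernel of the form $$K(\xi,\zeta)=\sum_{\ell_1=-\infty}^{\infty}\ \sum_{\ell,\ell'\in\Lambda_{|\ell_1|}}c_{\ell_1}(\ell,\ell')\,Y_{\ell_1,\ell}(\xi)\,\overline{Y_{\ell_1,\ell'}(\zeta)},\qquad \xi,\zeta\in\mathbb{S}^{d-1},$$ with $$\sum_{\ell_1=-\infty}^{\infty}\ \sum_{\ell,\ell'\in\Lambda_{|\ell_1|}}|c_{\ell_1}(\ell,\ell')|\,\frac{\sqrt{N_{\ell_{d-1},d}N_{\ell'_{d-1},d}}}{\sigma_{d-1}}<\infty .$$ For each $\ell_1\in\mathbb{Z}$ let $\alpha\mapsto\ell^{(\alpha)}=(\ell_2^{(\alpha)},\ldots,\ell_{d-1}^{(\alpha)})$, $\alpha=1,2,\ldots$, be a bijective enumeration of $\Lambda_{|\ell_1|}$ with $\ell_{d-1}^{(\alpha')}\le\ell_{d-1}^{(\alpha)}$ whenever $\alpha'<\alpha$, and for each integer $k\ge1$ let $A_{\ell_1}^k=\left(c_{\ell_1}(\ell^{(\alpha)},\ell^{(\alpha')})\right)_{\alpha,\alpha'=1}^{k}$. Suppose that $A_{\ell_1}^k$ is a (strictly) positive definite matrix for all $\ell_1\in\mathbb{Z}$ and all $k\ge1$, and that for every $\ell_1\in\mathbb{Z}$ there exist a sequence $d_j^{\ell_1}>0$, $j=1,2,\ldots$, and a number $\varepsilon_{\ell_1}>0$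 independent of $k$, such that for all $k\ge1$ the matrix $$\tilde A_{\ell_1}^k=A_{\ell_1}^kD_k,\qquad D_k=\left(\delta_{i,j}d_j^{\ell_1}\right)_{i,j=1}^k,$$ satisfies $\lambda_{\min}(\tilde A_{\ell_1}^k)>\varepsilon_{\ell_1}$, where $\lambda_{\min}$ denotes the smallest eigenvalue. Then $K$ is strictly positive definite on $\mathbb{S}^{d-1}$.
   Context: A Hermitian kernel $K:\Omega\times\Omega\to\mathbb{C}$ ($K(x,y)=\overline{K(y,x)}$) is called strictly positive definite on $\Omega$ if for every finite set $\Xi\subset\Omega$ of distinct points the matrix $(K(\xi,\zeta))_{\xi,\zeta\in\Xi}$ is positive definite on $\mathbb{C}^{|\Xi|}$. $\mathbb{S}^{d-1}$ is the unit sphere in $\mathbb{R}^d$ and $\sigma_{d-1}$ its surface area. $N_{0,d}=1$, $N_{j,d}=\frac{(2j+d-2)(j+d-3)!}{j!(d-2)!}$ for $j\ge1$. For $\ell_1\in\mathbb{Z}$, $\Lambda_{|\ell_1|}=\{\ell=(\ell_2,\ldots,\ell_{d-1})\in\mathbb{Z}^{d-2}:|\ell_1|\le\ell_2\le\cdots\le\ell_{d-1}\}$. In polar coordinates $\xi=(\theta_1,\ldots,\theta_{d-1})$, $\theta_1\in[0,2\pi)$, $\theta_j\in[0,\pi]$ for $j\ge2$ ($\xi_d=\cos\theta_{d-1}$, $\xi_{d-1}=\sin\theta_{d-1}\cos\theta_{d-2}$, ..., $\xi_2=\sin\theta_{d-1}\cdots\sin\theta_2\sin\theta_1$, $\xi_1=\sin\theta_{d-1}\cdots\sin\theta_2\cos\theta_1$),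 the functions $$Y_{\ell_1,\ell}(\xi)=Y_{\ell_1,\ldots,\ell_{d-1}}(\xi)=\frac{1}{\sqrt{2\pi}}e^{i\ell_1\theta_1}\prod_{j=2}^{d-1}{}_{j}\tilde P_{\ell_j}^{\ell_{j-1}}(\theta_j)$$ form an orthonormal basis of $L^2(\mathbb{S}^{d-1})$ of spherical harmonics ($Y_{\ell_1,\ell}$ has degree $\ell_{d-1}$), where ${}_{j}\tilde P_{L}^{\ell}(\theta)={}_{j}c_L^{\ell}(\sin\theta)^{(2-j)/2}P_{L+(j-2)/2}^{-(\ell+(j-2)/2)}(\cos\theta)$ (extended continuously to $\theta\in\{0,\pi\}$), $P_\nu^\mu$ are the associated Legendre functions on $(-1,1)$ and ${}_{j}c_L^{\ell}=\left(\frac{2L+j-1}{2}\frac{(L+\ell+j-2)!}{(L-\ell)!}\right)^{1/2}$. Axially symmetric means invariant under simultaneous rotation $\theta_1\mapsto\theta_1+\alpha$ of both arguments for every $\alpha$ (every kernel of the displayed form has this property). The matrix $A^k_{\ell_1}D_k$ is similar to the Hermitian matrix $\sqrt{D_k}A^k_{\ell_1}\sqrt{D_k}$, so its eigenvalues are real. *)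

(* Defs.v *)
From HB Require Import structures.
From mathcomp Require Import all_boot all_order all_algebra finmap.
From mathcomp Require Import all_classical all_reals all_analysis.
From mathcomp Require Import complex.

Set Implicit Arguments.
Unset Strict Implicit.
Unset Printing Implicit Defensive.

Import Order.TTheory GRing.Theory Num.Theory.
Import numFieldNormedType.Exports.

Local Open Scope classical_set_scope.
Local Open Scope ring_scope.
Local Open Scope complex_scope.
Local Open Scope sesquilinear_scope.

Section Matrices.
Variable R : realType.

(* For complex numbers, [0 < z] means that z is real and positive. *)
Definition posdefmx (n : nat) (A : 'M[R[i]]_n) : Prop :=
  A \is hermsymmx /\
  forall v : 'cV[R[i]]_n, v != 0 -> 0 < (v ^t* *m A *m v) 0 0.

(* In R[i], [lam%:C <= mu] also says that mu is real. *)
Definition is_lambda_min (n : nat) (A : 'M[R[i]]_n) (lam : R) : Prop :=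
  eigenvalue A lam%:C /\ forall mu : R[i], eigenvalue A mu -> lam%:C <= mu.

End Matrices.

Section Kernels.
Variables (R : realType) (T : Type).

Definition hermitian_kernel (Omega : set T) (K : T -> T -> R[i]) : Prop :=
  forall x y, Omega x -> Omega y -> K x y = Num.conj (K y x).

Definition strictly_posdef_kernel (Omega : set T) (K : T -> T -> R[i]) : Prop :=
  forall (n : nat) (x : 'I_n -> T), injective x -> (forall i, Omega (x i)) ->
    posdefmx (\matrix_(i < n, j < n) K (x i) (x j)).

End Kernels.

(* Unconditional convergence: the finite partial sums of f over {i | P i}
   converge to s along the directed set of finite sets of indices. *)
Definition has_sum (R : realType) (I : choiceType) (P : pred I)
    (f : I -> R[i]) (s : R[i]) : Prop :=
  forall eps : R, 0 < eps -> exists F0 : {fset I}, forall F : {fset I},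
    (F0 `<=` F)%fset -> `|s - \sum_(i <- F | P i) f i| < eps%:C.

Section SpecialFunctions.
Variable R : realType.
Implicit Types a b c x z mu nu theta : R.

(* 1 / Gamma(x) by Gauss's limit; it is defined for every real x and vanishes
   at the poles 0, -1, -2, ... of Gamma. *)
Definition inv_Gamma x : R :=
  limn (fun n : nat =>
    (\prod_(0 <= k < n.+1) (x + k%:R)) / (n`!%:R * n%:R `^ x)).

Definition pochhammer a (s : nat) : R := \prod_(0 <= k < s) (a + k%:R).

(* Regularized hypergeometric function 2F1(a, b; c; z) / Gamma(c), |z| < 1. *)
Definition reg_2F1 a b c z : R :=
  limn (series (fun s : nat =>
    pochhammer a s * pochhammer b s * inv_Gamma (c + s%:R) / s`!%:R * z ^+ s)).

(* Associated Legendre function P_nu^mu on the cut ]-1, 1[ (Ferrers function of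
   the first kind), for arbitrary real degree nu and order mu. *)
Definition assoc_legendre nu mu x : R :=
  ((1 + x) / (1 - x)) `^ (mu / 2) * reg_2F1 (nu + 1) (- nu) (1 - mu) ((1 - x) / 2).

(* The factorials are only used with L + l + j - 2 >= 0 and L - l >= 0. *)
Definition P_norm (j : nat) (L l : int) : R :=
  Num.sqrt ((2 * L%:~R + j%:R - 1) / 2
            * ((absz (L + l + j%:Z - 2)%R)`!%:R / (absz (L - l)%R)`!%:R)).

Definition P_tilde_open (j : nat) (L l : int) theta : R :=
  P_norm j L l * sin theta `^ ((2 - j%:R) / 2)
  * assoc_legendre (L%:~R + (j%:R - 2) / 2) (- (l%:~R + (j%:R - 2) / 2)) (cos theta).

(* Continuous extension of P_tilde_open from ]0, pi[ to [0, pi]. *)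
Definition P_tilde (j : nat) (L l : int) theta : R :=
  if (0 < theta) && (theta < pi) then P_tilde_open j L l theta
  else lim (P_tilde_open j L l t @[t --> within `]0, pi[ (nbhs theta)]).

End SpecialFunctions.

Section Sphere.
Variables (R : realType) (d : nat).

Definition sphere : set 'rV[R]_d := [set xi | \sum_(i < d) xi 0 i ^+ 2 = 1].

(* Angles are functions theta : nat -> R of which only theta 1, ..., theta d.-1
   matter.  Coordinates of 'rV_d are numbered from 0, so that the entry of
   index i is xi_(i+1). *)
Definition polar_angles (theta : nat -> R) : Prop :=
  (0 <= theta 1%N < 2 * pi) /\
  forall j : nat, (2 <= j < d)%N -> 0 <= theta j <= pi.

Definition polar_point (theta : nat -> R) : 'rV[R]_d :=
  \row_(i < d)
    match nat_of_ord i with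
    | 0 => (\prod_(2 <= j < d) sin (theta j)) * cos (theta 1%N)
    | 1 => (\prod_(2 <= j < d) sin (theta j)) * sin (theta 1%N)
    | k.+2 => (\prod_(k.+3 <= j < d) sin (theta j)) * cos (theta k.+2)
    end.

(* Polar coordinates of a point of the sphere.  Where they are not unique
   (sin (theta j) = 0 for some j >= 2) one choice is made; the spherical
   harmonics below do not depend on it. *)
Definition angles_of (xi : 'rV[R]_d) : nat -> R :=
  get [set theta | polar_angles theta /\ polar_point theta = xi].

(* theta 1 |-> theta 1 + alpha, i.e. the rotation by alpha in the plane of the
   first two coordinates, acting on row vectors by right multiplication. *)
Definition axial_rot (alpha : R) : 'M[R]_d :=
  \matrix_(i < d, j < d)
    match nat_of_ord i, nat_of_ord j with
    | 0, 0 => cos alpha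
    | 0, 1 => sin alpha
    | 1, 0 => - sin alpha
    | 1, 1 => cos alpha
    | _, _ => (i == j)%:R
    end.

Definition axially_symmetric (K : 'rV[R]_d -> 'rV[R]_d -> R[i]) : Prop :=
  forall (alpha : R) (xi zeta : 'rV[R]_d), sphere xi -> sphere zeta ->
    K (xi *m axial_rot alpha) (zeta *m axial_rot alpha) = K xi zeta.

(* Surface area 2 pi^(d/2) / Gamma(d/2) of the unit sphere of R^d. *)
Definition sphere_area : R := 2 * pi `^ (d%:R / 2) * inv_Gamma (d%:R / 2).

(* Dimension of the space of spherical harmonics of degree j in d variables. *)
Definition harm_dim (j : nat) : R :=
  if j == 0%N then 1
  else ((2 * j + d - 2) * (j + d - 3)`!)%:R / (j`! * (d - 2)`!)%:R.

(* (l_2, ..., l_(d-1)), stored from position 0. *)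
Definition multidx := (d.-2).-tuple int.

Definition Lambda (m : int) : pred multidx := fun l => path <=%O `|m| l.

Definition top_degree (l : multidx) : int := last 0 l.

Definition deg_at (l1 : int) (l : multidx) (j : nat) : int :=
  nth 0 (l1 :: l) j.-1.

Definition Y_polar (l1 : int) (l : multidx) (theta : nat -> R) : R[i] :=
  (Num.sqrt (2 * pi))^-1%:C
  * (cos (l1%:~R * theta 1%N) +i* sin (l1%:~R * theta 1%N))
  * (\prod_(2 <= j < d)
       P_tilde j (deg_at l1 l j) (deg_at l1 l j.-1) (theta j))%:C.

Definition Y (l1 : int) (l : multidx) (xi : 'rV[R]_d) : R[i] :=
  Y_polar l1 l (angles_of xi).

Definition term_idx := (int * multidx * multidx)%type.

Definition valid_idx : pred term_idx :=
  fun t => Lambda t.1.1 t.1.2 && Lambda t.1.1 t.2.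

Definition kernel_expansion (c : int -> multidx -> multidx -> R[i])
    (K : 'rV[R]_d -> 'rV[R]_d -> R[i]) : Prop :=
  forall xi zeta : 'rV[R]_d, sphere xi -> sphere zeta ->
    has_sum valid_idx
      (fun t : term_idx =>
         c t.1.1 t.1.2 t.2 * Y t.1.1 t.1.2 xi * Num.conj (Y t.1.1 t.2 zeta))
      (K xi zeta).

Definition coef_summable (c : int -> multidx -> multidx -> R[i]) : Prop :=
  (\esum_(t in [set t : term_idx | valid_idx t])
     (ComplexField.Normc.normc (c t.1.1 t.1.2 t.2)
      * (Num.sqrt (harm_dim (absz (top_degree t.1.2))
                   * harm_dim (absz (top_degree t.2)))
         / sphere_area))%:E < +oo)%E.

(* Enumeration of Lambda m, numbered from 0 and nondecreasing in the degree. *)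
Definition degree_enum (m : int) (e : nat -> multidx) : Prop :=
  set_bij [set: nat] [set l | Lambda m l] e /\
  {homo (fun a => top_degree (e a)) : a' a / (a' < a)%N >-> a' <= a}.

Definition coef_mx (c : multidx -> multidx -> R[i]) (e : nat -> multidx)
    (k : nat) : 'M[R[i]]_k :=
  \matrix_(a < k, b < k) c (e a) (e b).

Definition scale_mx (dj : nat -> R) (k : nat) : 'M[R[i]]_k :=
  diag_mx (\row_(j < k) (dj j)%:C).

End Sphere.

(* Main.v *)
(** The quadratic form of K at weights v is the sum over l1 of the forms of the
    coefficient blocks c_l1 at the vectors y_l = sum_i conj(v_i) Y_{l1,l}(x_i).
    On finite sections every block is nonnegative, and the eigenvalue hypothesis
    bounds block l1 below by eps |y_l|^2 / d_l, uniformly in the section; so the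
    form is positive as soon as one y_l is nonzero.

    That some y_l is nonzero is a separation property of the spherical harmonics
    with l1 >= 0.  By Euler's transformation of the hypergeometric series,
    P_tilde j (l + n) l theta = sin(theta)^l q(cos theta) with q of degree exactly
    n, so varying the degrees from the last one down separates first the values of
    the last angle, then of the one before, and so on. *)
Require Import Defs.
From mathcomp Require Import all_boot all_order all_algebra finmap.
From mathcomp Require Import all_classical all_reals all_analysis.
From mathcomp Require Import complex ring lra zify.

Set Implicit Arguments.
Unset Strict Implicit.
Unset Printing Implicit Defensive.

Import Order.TTheory GRing.Theory Num.Theory.
Import numFieldNormedType.Exports.

Local Open Scope classical_set_scope.
Local Open Scope ring_scope.
Local Open Scope complex_scope.
Local Open Scope sesquilinear_scope.

(** * The binomial series and its sum *)

Section BinomialSeries.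
Variable R : realType.
Implicit Types b z rho : R.

Lemma ratio_test (u : R^nat) (N : nat) rho : 0 < rho < 1 ->
  (forall s, (N <= s)%N -> `|u s.+1| <= rho * `|u s|) -> cvgn (series u).
Proof.
move=> /andP[rho0 rho1] uN; apply: normed_cvg.
(* Summing over all indices up to [N] lets [C * rho ^+ n] dominate from index 0 on: one summand
   suffices up to [N], the ratio bound afterwards. *)
pose C := \sum_(i < N.+1) `|u i| / rho ^+ i.
have C0 : 0 <= C by apply: sumr_ge0 => i _; rewrite divr_ge0 // exprn_ge0 // ltW.
apply: (@series_le_cvg _ _ (geometric C rho)) => [n|n|n|] //=.
- by rewrite mulr_ge0 // exprn_ge0 // ltW.
- elim: n => [|n IH].
    rewrite expr0 mulr1 /C big_ord_recl expr0 divr1 lerDl.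
    by apply: sumr_ge0 => i _; rewrite divr_ge0 // exprn_ge0 // ltW.
  have [nN|Nn] := ltnP n N.
    rewrite -ler_pdivrMr ?exprn_gt0 // /C (bigD1 (Ordinal (nN : (n.+1 < N.+1)%N))) //=.
    by rewrite lerDl sumr_ge0 // => i _; rewrite divr_ge0 // exprn_ge0 // ltW.
  apply: (le_trans (uN _ Nn)).
  by rewrite exprS mulrCA; apply: ler_wpM2l => //; exact: ltW.
- by apply: is_cvg_geometric_series; rewrite ger0_norm // ltW.
Qed.

(** The coefficient of z^s in (1 - z)^(-b). *)
Definition binom_coef b (s : nat) : R := pochhammer b s / s`!%:R.

Lemma pochhammer0 b : pochhammer b 0 = 1.
Proof. by rewrite /pochhammer big_geq. Qed.

Lemma pochhammerSr b s : pochhammer b s.+1 = pochhammer b s * (b + s%:R).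
Proof. by rewrite /pochhammer big_nat_recr. Qed.

Lemma pochhammerSl b s : pochhammer b s.+1 = b * pochhammer (b + 1) s.
Proof.
rewrite /pochhammer big_nat_recl // addr0; congr (_ * _).
by apply: eq_bigr => i _; rewrite -addrA -natr1 [1 + _]addrC.
Qed.

Lemma fact_neq0 s : s`!%:R != 0 :> R.
Proof. by rewrite pnatr_eq0 -lt0n fact_gt0. Qed.

Lemma binom_coef0 b : binom_coef b 0 = 1.
Proof. by rewrite /binom_coef pochhammer0 fact0 divr1. Qed.

Lemma binom_coefS b s :
  binom_coef b s.+1 = binom_coef b s * ((b + s%:R) / s.+1%:R).
Proof.
rewrite /binom_coef pochhammerSr factS natrM invfM.
by rewrite -!mulrA; congr (_ * _); rewrite [RHS]mulrCA; congr (_ * _); rewrite mulrC.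
Qed.

(** Coefficient form of the derivative of (1 - z)^(-b), which is b (1 - z)^(-(b + 1)). *)
Lemma binom_coef_diffs b : pseries_diffs (binom_coef b) =
  (fun s => b * binom_coef (b + 1) s).
Proof.
apply/funext => s; rewrite /pseries_diffs /binom_coef pochhammerSl factS natrM.
have := fact_neq0 s; have : s.+1%:R != 0 :> R by rewrite pnatr_eq0.
by move=> h1 h2; field; rewrite h2 addrC natr1 h1.
Qed.

(** Pascal's rule, the coefficient form of (1 - z)^(-b) = (1 - z) (1 - z)^(-(b + 1)). *)
Lemma binom_coef_shift b s :
  binom_coef b s.+1 = binom_coef (b + 1) s.+1 - binom_coef (b + 1) s.
Proof.
rewrite /binom_coef pochhammerSl pochhammerSr factS natrM.
have h2 := fact_neq0 s; have h1 : s%:R + 1 != 0 :> R by rewrite natr1 pnatr_eq0.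
by rewrite -natr1; field; rewrite h1 h2.
Qed.

Lemma is_cvg_binom_series b z : `|z| < 1 -> cvgn (pseries (binom_coef b) z).
Proof.
move=> z1; pose rho := (1 + `|z|) / 2.
have z0 := normr_ge0 z.
have rho01 : 0 < rho < 1 by rewrite /rho; apply/andP; split; lra.
have dpos : 0 < rho - `|z| by rewrite /rho; lra.
(* From [N] on, (|b| + s) |z| <= s rho, so consecutive terms have ratio at most [rho], the midpoint
   of |z| and 1. *)
pose N := Num.bound (`|b| / (rho - `|z|)).
apply: (@ratio_test _ N rho) => // s Ns.
have bs : `|b| <= s%:R * (rho - `|z|).
  rewrite -ler_pdivrMr //; apply: (@le_trans _ _ N%:R); last by rewrite ler_nat.
  by apply/ltW/archi_boundP; rewrite divr_ge0 // ltW.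
rewrite /= binom_coefS exprS; move: (binom_coef b s) => t.
rewrite !normrM [leLHS](_ : _ =
  `|(b + s%:R) / s.+1%:R| * `|z| * (`|t| * `|z ^+ s|)); last first.
  rewrite normrM; ring.
apply: ler_wpM2r; first by rewrite mulr_ge0.
rewrite normrM normfV normr_nat mulrAC ler_pdivrMr ?ltr0Sn //.
apply: (@le_trans _ _ ((`|b| + s%:R) * `|z|)).
  by apply: ler_wpM2r => //; rewrite (le_trans (ler_normD _ _)) // normr_nat.
rewrite -natr1.
have : `|b| * `|z| <= `|b| by rewrite ler_piMr // ltW.
move/andP: rho01 => [? ?].
nra.
Qed.

Lemma binom_series_shift b z : `|z| < 1 ->
  limn (pseries (binom_coef b) z) = (1 - z) * limn (pseries (binom_coef (b + 1)) z).
Proof.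
move=> z1; have cv := @is_cvg_binom_series (b + 1) _ z1.
apply/cvg_lim => //; rewrite -cvg_shiftS.
have -> : (fun n => pseries (binom_coef b) z n.+1) =
  (fun n => pseries (binom_coef (b + 1)) z n.+1 - z * pseries (binom_coef (b + 1)) z n).
  apply/funext => n; rewrite /pseries /series /=.
  elim: n => [|n IH].
    by rewrite !big_nat1 big_geq // mulr0 subr0 !binom_coef0.
  rewrite big_nat_recr //= IH [in RHS]big_nat_recr //= [in X in _ = _ - z * X]big_nat_recr //=.
  by rewrite binom_coef_shift exprS; ring.
rewrite mulrBl mul1r; apply: cvgB; first by rewrite cvg_shiftS.
exact: cvgMl_tmp.
Qed.

Lemma is_derive_binom_series b z : `|z| < 1 ->
  is_derive z 1 (fun x => limn (pseries (binom_coef b) x))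
    (b * limn (pseries (binom_coef (b + 1)) z)).
Proof.
move=> z1.
have cvZ (x a b' : R) : `|x| < 1 -> cvgn (pseries (fun s => a * binom_coef b' s) x) /\
   limn (pseries (fun s => a * binom_coef b' s) x) = a * limn (pseries (binom_coef b') x).
  move=> x1; have cv := @is_cvg_binom_series b' _ x1.
  have -> : pseries (fun s => a * binom_coef b' s) x =
            (fun n => a * pseries (binom_coef b') x n).
    apply/funext => n; rewrite /pseries /series /= mulr_sumr.
    by apply: eq_bigr => i _; rewrite mulrA.
  have h : a * pseries (binom_coef b') x n @[n --> \oo] -->
           a * limn (pseries (binom_coef b') x) by exact: cvgMl_tmp.
  by split; [apply/cvg_ex; eexists; exact: h | apply/cvg_lim].
(* Termwise differentiation at z uses convergence of the series and of its first two formal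
   derivatives at a point beyond |z|; the midpoint of |z| and 1 serves. *)
pose k := (1 + `|z|) / 2.
have z0 := normr_ge0 z.
have k1 : `|k| < 1 by rewrite /k ger0_norm; lra.
have zk : `|z| < `|k| by rewrite /k (@ger0_norm _ (_ / _)); lra.
rewrite -(cvZ _ _ _ z1).2 -binom_coef_diffs.
apply: (@pseries_snd_diffs _ _ k) => //.
- exact: is_cvg_binom_series.
- by rewrite binom_coef_diffs; apply: (cvZ _ _ _ k1).1.
rewrite binom_coef_diffs.
have -> : pseries_diffs (fun s => b * binom_coef (b + 1) s) =
   (fun s => (b * (b + 1)) * binom_coef (b + 1 + 1) s).
  apply/funext => s; rewrite /pseries_diffs mulrCA -/(pseries_diffs _ _).
  by rewrite [_ * _ in LHS](_ : _ = b * pseries_diffs (binom_coef (b + 1)) s) // binom_coef_diffs mulrA.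
exact: (cvZ _ _ _ k1).1.
Qed.

(** Writing f_b for the sum, f_b' = b f_(b+1) and f_b = (1 - x) f_(b+1) make the derivative of
    f_b(x) (1 - x)^b vanish on [0, z]; this product is 1 at 0. *)
Lemma binom_series b z : 0 <= z < 1 ->
  limn (pseries (binom_coef b) z) = (1 - z) `^ (- b).
Proof.
move=> /andP[z0 z1].
pose f x := limn (pseries (binom_coef b) x).
pose g x := f x * (1 - x) `^ b.
have norm1 (x : R) : 0 <= x -> x <= z -> `|x| < 1.
  by move=> x0 xz; rewrite ger0_norm //; exact: le_lt_trans xz z1.
have dg (x : R) : 0 <= x -> x <= z -> is_derive x 1 g 0.
  move=> x0 xz; have x1 := norm1 _ x0 xz.
  have p1 : 0 < 1 - x by rewrite subr_gt0; apply: le_lt_trans xz z1.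
  have d1 : is_derive x 1 (fun y : R => 1 - y) (-1).
    apply: is_derive_eq. by rewrite add0r mul1r.
  have d2 : is_derive x 1 (fun y : R => (1 - y) `^ b) (b * (1 - x) `^ (b - 1) * -1).
    exact: (@is_derive1_comp R (@powR R ^~ b) (fun y : R => 1 - y) x _ _ (is_derive1_powR b p1) d1).
  have d3 := is_derive_binom_series b x1.
  have := @is_deriveM _ _ f (fun y : R => (1 - y) `^ b) x 1 _ _ d3 d2.
  move=> h; apply: (is_derive_eq h).
  rewrite /f binom_series_shift // /GRing.scale /=.
  rewrite powRB; last by rewrite (gt_eqF p1) implybT.
  by rewrite powRr1 ?ltW //; field; rewrite gt_eqF.
have g0 : g 0 = 1.
  rewrite /g subr0 powR1 mulr1 /f; apply/cvg_lim => //.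
  rewrite -cvg_shiftS; apply: cvg_near_cst; apply: nearW => n.
  rewrite /pseries /series /= big_nat_recl // expr0 binom_coef0 mulr1 big1 ?addr0 //.
  by move=> i _; rewrite expr0n mulr0.
have gz : g z = 1.
  rewrite -g0; apply/eqP; rewrite -subr_eq0.
  have [||x _ ->] := @MVT_segment _ g (fun=> 0) 0 z z0.
  - move=> x; rewrite in_itv /= => /andP[/ltW x0 /ltW xz]; exact: dg.
  - apply: derivable_within_continuous => x; rewrite in_itv /= => /andP[x0 xz].
    by have [] := dg x x0 xz.
  by rewrite mul0r.
have p1 : 0 < 1 - z by rewrite subr_gt0.
rewrite powRN; apply: (@mulIf _ ((1 - z) `^ b)); first by rewrite gt_eqF ?powR_gt0.
by rewrite mulVf ?gt_eqF ?powR_gt0.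
Qed.

End BinomialSeries.

(** * Binomial series with polynomial weights *)

Section PolyBinomialSeries.
Variable R : realType.
Implicit Types b z : R.

Lemma cvg_binom_series b z : 0 <= z < 1 ->
  pseries (binom_coef b) z @ \oo --> (1 - z) `^ (- b).
Proof.
move=> z01; rewrite -binom_series //; apply: is_cvg_binom_series.
by move/andP: z01 => [z0 z1]; rewrite ger0_norm.
Qed.

(* Induction on n: p = q X + c splits off c times the binomial series, and the
   factor s in s q(s) shifts the index, leaving the series for q(X + 1) and
   b + 1. *)
Lemma poly_binom_series n (p : {poly R}) b : (size p <= n.+1)%N ->
  exists Q : {poly R}, [/\ (size Q <= n.+1)%N,
    Q`_n = (-1) ^+ n * p.[- b] &
    forall z, 0 <= z < 1 ->
      series (fun s => p.[s%:R] * binom_coef b s * z ^+ s) @ \oo -->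
        Q.[z] * (1 - z) `^ (- (b + n%:R))].
Proof.
elim: n p b => [|n IH] p b.
  move=> sp; have [c ->] : {c : R | p = c%:P} by exists p`_0; exact: size1_polyC.
  exists c%:P; split; first exact: size_polyC_leq1.
    by rewrite coefC hornerC expr0 mul1r.
  move=> z z01; rewrite hornerC addr0.
  have -> : series (fun s => c%:P.[s%:R] * binom_coef b s * z ^+ s) =
            (fun n => c * pseries (binom_coef b) z n).
    apply/funext => n; rewrite /pseries /series /= mulr_sumr.
    by apply: eq_bigr => i _; rewrite hornerC mulrA.
  by apply: cvgMl_tmp; exact: cvg_binom_series.
elim/poly_ind: p => [|q c _] sp.
  exists 0; split; first by rewrite size_poly0.
    by rewrite coef0 horner0 mulr0.
  move=> z _; rewrite horner0 mul0r.
  have -> : series (fun s => 0.[s%:R] * binom_coef b s * z ^+ s) = (fun=> 0).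
    by apply/funext => m; rewrite /series /= big1 // => i _; rewrite horner0 !mul0r.
  exact: cvg_cst.
have sq : (size q <= n.+1)%N.
  by move: sp; rewrite size_MXaddC; case: eqP => [->|_]; rewrite ?size_poly0 //=.
pose r := q \Po ('X + 1%:P).
have sr : (size r <= n.+1)%N by rewrite size_comp_poly2 // size_XaddC.
have [Q [sQ Qn cvQ]] := IH r (b + 1) sr.
(* The first summand is c (1 - z)^(n+1), which brings c (1 - z)^(-b) to the common exponent -(b + n
   + 1); the second comes from the shifted series. *)
exists ((-1) ^+ n.+1 * c *: ('X - 1%:P) ^+ n.+1 + b *: (Q * 'X)); split.
- apply: (leq_trans (size_polyD _ _)); rewrite geq_max.
  rewrite !(leq_trans (size_scale_leq _ _)) //.
    by apply: (leq_trans (size_polyMleq _ _)); rewrite size_polyX addn2.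
  by rewrite size_exp_XsubC.
- rewrite coefD !coefZ coefMX /= Qn.
  have /monicP := monic_exp n.+1 (monicXsubC (1 : R)).
  rewrite lead_coefE size_exp_XsubC /= => ->.
  rewrite hornerMXaddC /r horner_comp hornerD hornerX hornerC exprS.
  rewrite (_ : - (b + 1) + 1 = - b); last by ring.
  by ring.
move=> z z01; have [z0 z1] := andP z01.
have cv1 := @cvg_binom_series b _ z01; have cv2 := cvQ z z01.
(* The factor s kills the term s = 0 of s q(s), so N + 1 terms on the left match N terms of the
   shifted series. *)
rewrite -cvg_shiftS.
have -> : (fun N => series (fun s => (q * 'X + c%:P).[s%:R] * binom_coef b s * z ^+ s) N.+1) =
  (fun N => c * pseries (binom_coef b) z N.+1 + z * b *
      series (fun s => r.[s%:R] * binom_coef (b + 1) s * z ^+ s) N).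
  apply/funext => N; rewrite /pseries /series /=.
  elim: N => [|N IHN].
    by rewrite !big_nat1 big_geq // mulr0 addr0 hornerMXaddC mulr0 add0r -mulrA.
  rewrite big_nat_recr //= IHN.
rewrite [in RHS]big_nat_recr //=.
rewrite [X in _ = _ + _ * X]big_nat_recr //=.
  have := congr1 (fun f => f N) (binom_coef_diffs b); rewrite /pseries_diffs /= => E.
  rewrite hornerMXaddC /r horner_comp hornerD hornerX hornerC natr1 exprS.
  set B := \big[_/_]_(_ <= _ < _) _; set C := \big[_/_]_(_ <= _ < _) _.
  transitivity (c * B + z * b * C +
    (q.[N.+1%:R] * (N.+1%:R * binom_coef b N.+1) + c * binom_coef b N.+1) * (z * z ^+ N)).
    by ring.
  by rewrite E; ring.
rewrite hornerD !hornerZ horner_exp hornerXsubC hornerMX.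
have p1 : 0 < 1 - z by rewrite subr_gt0.
have -> : ((-1) ^+ n.+1 * c * (z - 1) ^+ n.+1 + b * (Q.[z] * z)) *
   (1 - z) `^ (- (b + n.+1%:R)) =
   c * (1 - z) `^ (- b) + z * b * (Q.[z] * (1 - z) `^ (- (b + 1 + n%:R))).
  have -> : b + 1 + n%:R = b + n.+1%:R by rewrite -natr1; ring.
  have -> : (1 - z) `^ (- b) = (1 - z) ^+ n.+1 * (1 - z) `^ (- (b + n.+1%:R)).
    rewrite -powR_mulrn ?ltW // -powRD; last by rewrite (gt_eqF p1) implybT.
    by congr (_ `^ _); ring.
  rewrite -(opprB z 1) [(- (z - 1)) ^+ n.+1]exprNn.
  by move: ((-1) ^+ n.+1) ((z - 1) ^+ n.+1) => A B; ring.
apply: cvgD; apply: cvgMl_tmp => //.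
by rewrite cvg_shiftS.
Qed.

End PolyBinomialSeries.

(** * Gauss's limit for 1/Gamma at positive arguments *)

Section InvGamma.
Variable R : realType.
Implicit Types t x c : R.

(** Bernoulli's inequality for exponents in ]0, 1[ is Young's inequality for (1 + t)^x and 1 with
    conjugate exponents 1/x and 1/(1 - x). *)
Lemma powR_bernoulli t x : 0 < x <= 1 -> 0 <= 1 + t -> (1 + t) `^ x <= 1 + t * x.
Proof.
move=> /andP[x0]; rewrite le_eqVlt => /orP[/eqP -> t0|x1 t0].
  by rewrite powRr1 // mulr1.
have := @conjugate_powR _ ((1 + t) `^ x) 1 x^-1 (1 - x)^-1 (powR_ge0 _ _) ler01.
rewrite !invr_gt0 subr_gt0 => /(_ x0 x1); rewrite !invrK subrKC => /(_ erefl).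
rewrite mulr1 -powRrM divff ?gt_eqF // powRr1 // powR1 mul1r => /le_trans; apply.
by rewrite [leLHS](_ : _ = 1 + t * x) //; ring.
Qed.

Definition gauss x (n : nat) : R :=
  (\prod_(0 <= k < n.+1) (x + k%:R)) / (n`!%:R * n%:R `^ x).

Lemma gaussE x n : gauss x n = pochhammer x n.+1 / (n`!%:R * n%:R `^ x).
Proof. by []. Qed.

Lemma pochhammer_gt0 x n : 0 < x -> 0 < pochhammer x n.
Proof.
by move=> x0; apply: prodr_gt0 => i _; rewrite ltr_wpDr.
Qed.

(** This bound keeps the limit away from 0. Indices start at 1 because the denominator of
    [gauss x 0] contains 0^x = 0. *)
Lemma gauss_ge x n : 0 < x <= 1 -> x <= gauss x n.+1.
Proof.
move=> /andP[x0 x1].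
(* Induction with denominators cleared; Bernoulli bounds (1 + 1/(n+1))^x by 1 + x/(n+1), which gives
   exactly the new factor x + n + 1. *)
have H : x * (n.+1%:R `^ x * n`!%:R) <= pochhammer x n.+1.
  elim: n => [|n IH].
    by rewrite powR1 mul1r mulr1 pochhammerSr pochhammer0 mul1r addr0.
  have n0 : 0 < n.+1%:R :> R by [].
  have -> : n.+2%:R = n.+1%:R * (1 + n.+1%:R^-1) :> R.
    by rewrite mulrDr mulr1 divff ?gt_eqF // natr1.
  rewrite powRM ?addr_ge0 ?invr_ge0 //.
  have B : (1 + n.+1%:R^-1) `^ x <= 1 + n.+1%:R^-1 * x.
    by apply: powR_bernoulli; rewrite ?x0 // addr_ge0 // invr_ge0.
  rewrite pochhammerSr factS natrM.
  apply: (@le_trans _ _ (x * (n.+1%:R `^ x * n`!%:R) * (n.+1%:R * (1 + n.+1%:R^-1 * x)))).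
    rewrite [leLHS](_ : _ = x * (n.+1%:R `^ x * n`!%:R) * (n.+1%:R * (1 + n.+1%:R^-1) `^ x)); last by ring.
    by apply: ler_wpM2l; rewrite ?ler_wpM2l // !mulr_ge0 ?powR_ge0 // ltW.
  rewrite (_ : n.+1%:R * (1 + _) = x + n.+1%:R); last by field; rewrite addrC natr1 gt_eqF.
  by apply: ler_wpM2r IH; rewrite addr_ge0 // ltW.
rewrite gaussE ler_pdivlMr; last by rewrite mulr_gt0 ?powR_gt0 // ltr0n fact_gt0.
rewrite pochhammerSr factS natrM.
rewrite [leLHS](_ : _ = x * (n.+1%:R `^ x * n`!%:R) * n.+1%:R); last by ring.
apply: ler_pM => //; last by rewrite lerDr ltW.
by rewrite !mulr_ge0 ?powR_ge0 // ltW.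
Qed.

(** With m = n + 2, Bernoulli for (1 - 1/m)^x reduces the claim to (x + m) (1 - x/m) = m - x^2/m <=
    m. *)
Lemma gauss_nonincreasing x n : 0 < x <= 1 -> gauss x n.+2 <= gauss x n.+1.
Proof.
move=> x01; have /andP[x0 x1] := x01.
have f0 : 0 < (n.+1)`!%:R :> R by rewrite ltr0n fact_gt0.
rewrite !gaussE pochhammerSr ler_pdivrMr; last first.
  by rewrite mulr_gt0 ?powR_gt0 // ltr0n fact_gt0.
rewrite mulrAC ler_pdivlMr ?mulr_gt0 ?powR_gt0 //.
rewrite -mulrA; apply: ler_wpM2l; first exact/ltW/pochhammer_gt0.
rewrite [(n.+2)`!]factS natrM.
set m : R := n.+2%:R.
have m0 : 0 < m by [].
have m1 : 1 <= m by rewrite ler1n.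
have -> : n.+1%:R = m * (1 - m^-1) :> R.
  by rewrite mulrBr mulr1 divff ?gt_eqF // /m -[n.+2%:R]natr1 addrK.
have q0 : 0 <= 1 - m^-1 by rewrite subr_ge0 invf_le1.
rewrite (powRM _ (ltW m0) q0).
have B : (1 - m^-1) `^ x <= 1 - m^-1 * x.
  by rewrite -mulNr; apply: powR_bernoulli.
have P0 : 0 <= m `^ x by exact: powR_ge0.
rewrite [leLHS](_ : _ = (n.+1)`!%:R * m `^ x * ((x + m) * (1 - m^-1) `^ x)); last by ring.
rewrite [leRHS](_ : _ = (n.+1)`!%:R * m `^ x * m); last by ring.
apply: ler_wpM2l; first by rewrite mulr_ge0 // ltW.
apply: (@le_trans _ _ ((x + m) * (1 - m^-1 * x))).
  by apply: ler_wpM2l => //; rewrite addr_ge0 // ltW.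
rewrite [leLHS](_ : _ = m - x ^+ 2 / m); last by field; rewrite gt_eqF.
by rewrite gerBl divr_ge0 ?sqr_ge0 // ltW.
Qed.

Lemma gauss_add1 x n : 0 < x ->
  gauss (x + 1) n.+1 = gauss x n.+1 * (x^-1 * (1 + (x + 1) * harmonic n)).
Proof.
move=> x0; rewrite !gaussE.
have -> : pochhammer (x + 1) n.+2 = pochhammer x n.+2 * ((x + n.+2%:R) / x).
  apply: (@mulfI _ x); first by rewrite gt_eqF.
  by rewrite -pochhammerSl pochhammerSr; field; rewrite gt_eqF.
have n0 : 0 < n.+1%:R :> R by [].
have p0 : 0 < n.+1%:R `^ x :> R by exact: powR_gt0.
rewrite powRD ?powRr1 ?(gt_eqF n0) ?implybT //= -[n.+2%:R]natr1.
have := fact_neq0 R n.+1.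
move: (n.+1%:R `^ x) (n.+1)`!%:R p0 (n.+1%:R) n0 => P F p0 N n0 F0.
by field; rewrite F0 !gt_eqF ?powR_gt0.
Qed.

(** On ]0, 1] the sequence decreases and stays above x. Larger arguments are reached by unit steps,
    each of which multiplies the limit by the nonzero factor 1/(x - 1). *)
Lemma gauss_cvg x : 0 < x -> exists2 l : R, l != 0 & gauss x @ \oo --> l.
Proof.
have base y : 0 < y <= 1 -> exists2 l : R, l != 0 & gauss y n.+1 @[n --> \oo] --> l.
  move=> y01; have /andP[y0 y1] := y01.
  have cv : cvgn (fun n => gauss y n.+1).
    apply: nonincreasing_is_cvgn.
      by apply/nonincreasing_seqP => n; exact: gauss_nonincreasing.
    by exists y => _ [n _ <-]; exact: gauss_ge.
  exists (limn (fun n => gauss y n.+1)) => //.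
  rewrite gt_eqF // (lt_le_trans y0) //; apply: limr_ge => //.
  by apply: nearW => n; exact: gauss_ge.
move=> x0; suff [l l0 cv] : exists2 l : R, l != 0 & gauss x n.+1 @[n --> \oo] --> l.
  by exists l => //; rewrite -cvg_shiftS.
have : x <= (Num.bound x).+1%:R.
  by apply: ltW; rewrite (lt_trans (archi_boundP (ltW x0))) // ltr_nat.
move: (Num.bound x) => m; elim: m x x0 => [|m IH] x x0 xm; first by apply: base; rewrite x0.
have [x1|x1] := leP x 1; first by apply: base; rewrite x0.
have y0 : 0 < x - 1 by rewrite subr_gt0.
have [|l l0 cv] := IH (x - 1) y0; first by rewrite lerBlDr natr1.
exists (l * ((x - 1)^-1 * (1 + (x - 1 + 1) * 0))).
  by rewrite mulr0 addr0 mulr1 mulf_neq0 // invr_neq0 // gt_eqF.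
have -> : (fun n => gauss x n.+1) =
  (fun n => gauss (x - 1) n.+1 * ((x - 1)^-1 * (1 + (x - 1 + 1) * harmonic n))).
  by apply/funext => n; rewrite -gauss_add1 // subrK.
apply: cvgM => //; apply: cvgMl_tmp; apply: cvgD; first exact: cvg_cst.
by apply: cvgMl_tmp; exact: cvg_harmonic.
Qed.

Lemma inv_Gamma_neq0 x : 0 < x -> inv_Gamma x != 0.
Proof. by move=> /gauss_cvg[l l0 /cvg_lim cv]; rewrite /inv_Gamma cv. Qed.

Lemma inv_Gamma_add1 x : 0 < x -> inv_Gamma (x + 1) = inv_Gamma x / x.
Proof.
move=> x0; have [l l0 cv] := gauss_cvg x0.
rewrite /inv_Gamma (cvg_lim _ cv) //; apply/cvg_lim => //.
suff : gauss (x + 1) n.+1 @[n --> \oo] --> l / x by rewrite (cvg_shiftS (gauss _)).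
have -> : (fun n => gauss (x + 1) n.+1) =
  (fun n => gauss x n.+1 * (x^-1 * (1 + (x + 1) * harmonic n))).
  by apply/funext => n; rewrite gauss_add1.
have -> : l / x = l * (x^-1 * (1 + (x + 1) * 0)) by rewrite mulr0 addr0 mulr1.
apply: cvgM; first by rewrite (cvg_shiftS (gauss x)).
apply: cvgMl_tmp; apply: cvgD; first exact: cvg_cst.
by apply: cvgMl_tmp; exact: cvg_harmonic.
Qed.

Lemma inv_Gamma_addn c s : 0 < c ->
  inv_Gamma (c + s%:R) = inv_Gamma c / pochhammer c s.
Proof.
move=> c0; elim: s => [|s IH]; first by rewrite addr0 pochhammer0 divr1.
rewrite -natr1 addrA inv_Gamma_add1 ?IH ?pochhammerSr ?invfM ?mulrA //.
by rewrite ltr_wpDr.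
Qed.

End InvGamma.

(** * Associated Legendre functions as a power of the sine times a polynomial in the cosine *)

Section LegendrePolynomials.
Variable R : realType.
Implicit Types b c theta : R.

Lemma pochhammerD c m s :
  pochhammer c (m + s) = pochhammer c m * pochhammer (c + m%:R) s.
Proof.
elim: s => [|s IH]; first by rewrite addn0 pochhammer0 mulr1.
by rewrite addnS !pochhammerSr IH natrD mulrA addrA.
Qed.

Definition pochhammer_poly c n : {poly R} := \prod_(0 <= k < n) ('X + (c + k%:R)%:P).

Lemma horner_pochhammer_poly c n x : (pochhammer_poly c n).[x] = pochhammer (c + x) n.
Proof.
rewrite /pochhammer_poly /pochhammer horner_prod; apply: eq_bigr => i _.
by rewrite hornerD hornerX hornerC addrCA addrA.
Qed.

Lemma size_pochhammer_poly c n : size (pochhammer_poly c n) = n.+1.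
Proof.
rewrite /pochhammer_poly big_mkord.
rewrite (eq_bigr (fun i : 'I_n => 'X - (- (c + i%:R))%:P)); last first.
  by move=> i _; rewrite polyCN opprK.
by rewrite size_prod_XsubC -[index_enum _]enumT size_enum_ord.
Qed.

(* (c+n)_s / (c)_s = (c+s)_n / (c)_n is a polynomial of degree n in s. *)
Lemma reg_2F1_poly c n b : 0 < c -> 0 < c - b ->
  exists2 Q : {poly R}, size Q = n.+1 &
    forall z, 0 <= z < 1 ->
      reg_2F1 (c + n%:R) b c z = Q.[z] * (1 - z) `^ (- (b + n%:R)).
Proof.
move=> c0 cb0.
pose a := inv_Gamma c / pochhammer c n.
have a0 : a != 0 by rewrite mulf_neq0 ?inv_Gamma_neq0 // invr_neq0 // gt_eqF // pochhammer_gt0.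
have sp : (size (a *: pochhammer_poly c n) <= n.+1)%N.
  by rewrite size_scale // size_pochhammer_poly.
have [Q [sQ Qn cvQ]] := poly_binom_series b sp.
exists Q.
  (* The coefficient of degree n is, up to sign, the weight at -b, a nonzero multiple of (c - b)_n >
     0; so the degree does not drop. *)
  apply/eqP; rewrite eqn_leq sQ ltnNge /=; apply/negP => /leq_sizeP/(_ n (leqnn n))/eqP.
  rewrite Qn hornerZ horner_pochhammer_poly mulf_eq0 signr_eq0 /= mulf_eq0 (negbTE a0) /=.
  by rewrite gt_eqF // pochhammer_gt0.
move=> z z01; rewrite /reg_2F1; apply/cvg_lim => //.
rewrite [X in series X](_ : _ = fun s => (a *: pochhammer_poly c n).[s%:R] * binom_coef b s * z ^+ s).
  exact: cvQ.
apply/funext => s; congr (_ * _).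
rewrite hornerZ horner_pochhammer_poly inv_Gamma_addn // /binom_coef /a.
have := pochhammerD c n s; rewrite addnC pochhammerD => E.
have p0 m : pochhammer c m != 0 by rewrite gt_eqF // pochhammer_gt0.
have -> : pochhammer (c + n%:R) s = pochhammer c s * pochhammer (c + s%:R) n / pochhammer c n.
  by rewrite E mulrAC divff // mul1r.
by field; rewrite !p0 fact_neq0.
Qed.

(** Evaluates the continuous extension built into [P_tilde]. Properness of the filter at the
    endpoints makes the limit unique. *)
Lemma lim_within_oo (f g : R -> R) theta :
  0 <= theta <= pi -> continuous g ->
  (forall t, 0 < t < pi -> f t = g t) ->
  lim (f t @[t --> within `]0, pi[ (nbhs theta)]) = g theta.
Proof.
move=> /andP[th0 thpi] cg fg.
have PF : ProperFilter (within `]0, pi[ (nbhs theta)).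
  apply: within_nbhs_proper => B /nbhs_ballP[/= e e0 eB].
  have pi0 := pi_gt0 R.
  (* Moving theta towards pi/2 by the fraction [a] lands inside the open interval, at distance at
     most e/2. *)
  pose a := Num.min 2^-1 (e / pi).
  have a0 : 0 < a by rewrite lt_min invr_gt0 ltr0n divr_gt0.
  have a1 : a <= 2^-1 by rewrite ge_min lexx.
  have ae : a * pi <= e by rewrite -ler_pdivlMr // ge_min lexx orbT.
  exists (theta + (pi / 2 - theta) * a); split.
    by rewrite /= in_itv /=; apply/andP; split; nra.
  apply: eB; rewrite /ball /= opprD addNKr normrN normrM (gtr0_norm a0).
  have : `|pi / 2 - theta| <= pi / 2 by rewrite ler_norml; apply/andP; split; lra.
  by move=> h; nra.
apply/cvg_lim => //.
apply: (@cvg_trans _ (g t @[t --> within `]0, pi[ (nbhs theta)])).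
  apply: near_eq_cvg; rewrite near_withinE; apply: nearW => t.
  by rewrite /= in_itv /= => /fg.
apply: (@cvg_trans _ (g t @[t --> theta])); last exact: cg.
exact: (cvg_app g (cvg_within `]0, pi[)). 
Qed.

Lemma sin2_factor theta : sin theta ^+ 2 = (1 + cos theta) * (1 - cos theta).
Proof. by rewrite sin2cos2; ring. Qed.

Lemma cos_bounds theta : 0 < theta < pi -> -1 < cos theta < 1.
Proof.
move=> th; have s0 := sin_gt0_pi th; have := sin2_factor theta.
have c1 := cos_le1 theta; have c2 := cos_geN1 theta.
have : 0 < sin theta ^+ 2 by rewrite exprn_gt0.
by move=> h1 h2; apply/andP; split; nra.
Qed.

Lemma P_norm_gt0 j l n : (2 <= j)%N -> 0 < P_norm R j (l + n)%N%:Z l%:Z.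
Proof.
move=> j2; rewrite /P_norm sqrtr_gt0 mulr_gt0 //.
rewrite divr_gt0 // -addrA ltr_wpDl ?mulr_ge0 ?ler0z //.
by rewrite subr_gt0 ltr1n.
Qed.

Lemma P_tilde_poly j l n : (2 <= j)%N ->
  exists2 q : {poly R}, size q = n.+1 &
    forall theta, 0 <= theta <= pi ->
      P_tilde j (l + n)%N%:Z l%:Z theta = sin theta ^+ l * q.[cos theta].
Proof.
move=> j2.
(* The order of the Legendre function is -(l + s) = -2h and its hypergeometric parameters are c + n,
   b and c. Since b + n = -2h, the Euler factor is ((1 + cos theta)/2)^(2h). *)
pose s : R := (j%:R - 2) / 2.
have s0 : 0 <= s by rewrite divr_ge0 // subr_ge0 ler_nat.
pose h : R := (l%:R + s) / 2.
pose c : R := l%:R + s + 1.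
pose b : R := - (l%:R + n%:R + s).
have c0 : 0 < c by rewrite /c ltr_wpDl // addr_ge0.
have n0 : 0 <= n%:R :> R by [].
have l0 : 0 <= l%:R :> R by [].
have cb0 : 0 < c - b by rewrite /c /b; lra.
have [Q sQ QE] := reg_2F1_poly n c0 cb0.
(* [k] collects the normalization and the 2^(-2h) of the Euler factor. *)
pose k := P_norm R j (l + n)%N%:Z l%:Z * 2^-1 `^ (2 * h).
pose q := k *: (Q \Po (2^-1 *: (1%:P - 'X))).
have k0 : k != 0 by rewrite gt_eqF // mulr_gt0 ?P_norm_gt0 // powR_gt0.
have sq : size q = n.+1.
  rewrite size_scale // size_comp_poly2 // size_scale ?invr_neq0 ?pnatr_eq0 //.
  by rewrite -opprB size_polyN size_XsubC.
have E theta : 0 < theta < pi ->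
    P_tilde_open j (l + n)%N%:Z l%:Z theta = sin theta ^+ l * q.[cos theta].
  move=> th; have sn0 := sin_gt0_pi th; have /andP[x1 x2] := cos_bounds th.
  rewrite /P_tilde_open /assoc_legendre.
  have -> : ((l + n)%N%:Z)%:~R + (j%:R - 2) / 2 + 1 = c + n%:R :> R.
    by rewrite -pmulrn natrD -/s /c; ring.
  have -> : - (((l + n)%N%:Z)%:~R + (j%:R - 2) / 2) = b :> R.
    by rewrite -pmulrn natrD -/s /b; ring.
  have -> : 1 - - (l%:Z%:~R + (j%:R - 2) / 2) = c :> R.
    by rewrite -pmulrn -/s /c; ring.
  have -> : - (l%:Z%:~R + (j%:R - 2) / 2) / 2 = - h :> R.
    by rewrite -pmulrn -/s /h; field.
  have -> : (2 - j%:R) / 2 = - s by rewrite /s; field.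
  rewrite QE; last by apply/andP; split; lra.
  have -> : - (b + n%:R) = 2 * h by rewrite /b /h; field.
  have -> : 1 - (1 - cos theta) / 2 = (1 + cos theta) * 2^-1 by field.
  rewrite /q hornerZ horner_comp hornerZ hornerD hornerN hornerX hornerC.
  rewrite [2^-1 * (1 - _)]mulrC /k.
  set u := 1 + cos theta; set v := 1 - cos theta.
  have u0 : 0 < u by rewrite /u; lra.
  have v0 : 0 < v by rewrite /v; lra.
  set X := Q.[_]; set N := P_norm _ _ _ _.
  have -> : (u * 2^-1) `^ (2 * h) = u `^ h * u `^ h * 2^-1 `^ (2 * h).
    rewrite powRM ?invr_ge0 ?(ltW u0) // -powRD; last by rewrite (gt_eqF u0) implybT.
    by rewrite -mulr2n mulr_natl.
  have -> : (u / v) `^ (- h) = v `^ h / u `^ h.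
    rewrite powRM ?invr_ge0 ?(ltW u0) ?(ltW v0) //.
    by rewrite -[v^-1]powR_inv1 ?(ltW v0) // -powRrM mulN1r opprK powRN mulrC.
  have uh : u `^ h != 0 by rewrite gt_eqF // powR_gt0.
  (* Both sides are sin(theta)^(2h) with 2h = l + s; the power s cancels against the prefactor
     sin(theta)^(-s). *)
  have E2 : u `^ h * v `^ h = sin theta `^ s * sin theta ^+ l.
    rewrite -powRM ?(ltW u0) ?(ltW v0) // -sin2_factor -powR_mulrn ?(ltW sn0) //.
    rewrite -powRrM -powR_mulrn ?(ltW sn0) // -powRD; last by rewrite (gt_eqF sn0) implybT.
    by congr (_ `^ _); rewrite /h; field.
  have ss : sin theta `^ s != 0 by rewrite gt_eqF // powR_gt0.
  rewrite powRN.
  transitivity (N * (sin theta `^ s)^-1 * X * 2^-1 `^ (2 * h) * (u `^ h * v `^ h)).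
    by move: (u `^ h) (v `^ h) (sin _ `^ s) (_ `^ (2 * h)) uh ss => A B C D A0 C0; field; rewrite A0 C0.
  by rewrite E2; move: (sin _ `^ s) (_ `^ (2 * h)) ss => C D C0; field.
exists q => // theta th; rewrite /P_tilde; case: ifP => [|_]; first exact: E.
apply: (@lim_within_oo _ (fun t => sin t ^+ l * q.[cos t])) => //.
move=> t; apply: cvgM.
  apply: (@continuous_comp _ _ _ (@sin R) (fun x => x ^+ l)); first exact: continuous_sin.
  exact: exprn_continuous.
apply: (@continuous_comp _ _ _ (@cos R) (horner q)); first exact: continuous_cos.
exact: continuous_horner.
Qed.

End LegendrePolynomials.


(** * Separation of points by their polar angles *)

Lemma poly_separation (F : fieldType) (I : finType) (q : nat -> {poly F})
    (x u : I -> F) :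
  (forall n, size (q n) = n.+1) -> (forall n, \sum_i u i * (q n).[x i] = 0) ->
  forall t, \sum_(i | x i == t) u i = 0.
Proof.
move=> sq uq.
(* Since [q n] has degree exactly n, subtracting a multiple of it lowers the degree of any p of
   degree n; hence the relations extend to all polynomials. *)
have up (p : {poly F}) : \sum_i u i * p.[x i] = 0.
  have [m] := ubnP (size p); elim: m p => // m IH p.
  have [-> _|p0] := eqVneq p 0; first by rewrite big1 // => i _; rewrite horner0 mulr0.
  rewrite ltnS => sp; pose n := (size p).-1.
  have spn : size p = n.+1 by rewrite prednK // lt0n size_poly_eq0.
  pose a := lead_coef p / lead_coef (q n).
  have qn0 : lead_coef (q n) != 0 by rewrite lead_coef_eq0 -size_poly_eq0 sq.
  have a0 : a != 0 by rewrite mulf_neq0 ?invr_neq0 // lead_coef_eq0.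
  have lt : (size (p - a *: q n)%R < size p)%N.
    rewrite spn ltnS; apply/leq_sizeP => j; rewrite leq_eqVlt => /orP[/eqP <-|nj].
      rewrite coefB coefZ.
      have -> : (q n)`_n = lead_coef (q n) by rewrite lead_coefE sq.
      by rewrite divfK // lead_coefE spn subrr.
    apply: nth_default; apply: leq_trans nj.
    apply: (leq_trans (size_polyD _ _)); rewrite geq_max size_polyN spn leqnn.
    by rewrite size_scale // sq leqnn.
  have := IH _ (leq_trans lt sp).
  have -> : \sum_i u i * (p - a *: q n).[x i] =
    \sum_i u i * p.[x i] - a * \sum_i u i * (q n).[x i].
    by rewrite mulr_sumr -sumrB; apply: eq_bigr => i _; rewrite hornerD hornerN hornerZ; ring.
  by rewrite uq mulr0 subr0.
(* [p] vanishes at every value of x except t, so it isolates the fibre over t. *)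
move=> t; pose p := \prod_(i | x i != t) ('X - (x i)%:P).
have pt : p.[t] != 0.
  rewrite /p horner_prod; apply/prodf_neq0 => i xt.
  by rewrite hornerXsubC subr_eq0 eq_sym.
apply: (mulIf pt); rewrite mul0r -[RHS](up p) mulr_suml.
rewrite [RHS](bigID (fun i => x i == t)) /= [X in _ = _ + X]big1 ?addr0; last first.
  by move=> i xt; rewrite /p horner_prod (bigD1 i) //= hornerXsubC subrr mul0r mulr0.
by apply: eq_bigr => i /eqP ->.
Qed.

Section Separation.
Variable R : realType.
Implicit Types (theta phi : nat -> R) (g : nat -> nat).

(* Equality of the points of the sphere of dimension k + 1 with polar angles
   theta 1, ..., theta k.+1 and phi 1, ..., phi k.+1. *)
Fixpoint same_point k theta phi : Prop :=
  match k with
  | 0 => cos (theta 1%N) = cos (phi 1%N) /\ sin (theta 1%N) = sin (phi 1%N)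
  | k'.+1 => theta k'.+2 = phi k'.+2 /\
      (sin (theta k'.+2) = 0 \/ same_point k' theta phi)
  end.

Definition polar_factor k g theta : R :=
  \prod_(2 <= j < k.+2) P_tilde j (g j)%:Z (g j.-1)%:Z (theta j).

(** The spherical harmonic with degrees l_j = [g j], up to the factor 1/sqrt(2 pi). Natural degrees
    restrict it to l_1 >= 0. *)
Definition harmonic_poly k g theta : R[i] :=
  (cos ((g 1%N)%:R * theta 1%N) +i* sin ((g 1%N)%:R * theta 1%N)) *
  (polar_factor k g theta)%:C.

Lemma harmonic_poly_recr k g theta :
  harmonic_poly k.+1 g theta = harmonic_poly k g theta *
    (P_tilde k.+2 (g k.+2)%:Z (g k.+1)%:Z (theta k.+2))%:C.
Proof. by rewrite /harmonic_poly /polar_factor big_nat_recr //= rmorphM mulrA. Qed.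

Lemma eq_polar_factor k g g' theta : (forall j, (j <= k.+1)%N -> g j = g' j) ->
  polar_factor k g theta = polar_factor k g' theta.
Proof.
move=> gg; apply: eq_big_nat => j /andP[_ jk].
by rewrite (gg j jk) (gg j.-1 (leq_trans (leq_pred j) jk)).
Qed.

Lemma eq_harmonic_poly k g g' theta : (forall j, (j <= k.+1)%N -> g j = g' j) ->
  harmonic_poly k g theta = harmonic_poly k g' theta.
Proof.
by move=> gg; rewrite /harmonic_poly (gg 1%N isT) (eq_polar_factor theta gg).
Qed.

(** When all degrees are 0 every factor is a nonzero constant, even where a sine vanishes. *)
Lemma harmonic_poly0_neq0 k theta :
  (forall j, (2 <= j < k.+2)%N -> 0 <= theta j <= pi) ->
  harmonic_poly k (fun=> 0%N) theta != 0.
Proof.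
move=> th; rewrite /harmonic_poly mul0r cos0 sin0 -[1 +i* 0]/(1%:C) rmorph1 mul1r.
rewrite fmorph_eq0 /polar_factor prodf_seq_neq0.
apply/allP => j; rewrite mem_index_iota => jk; apply/implyP => _.
have j2 : (2 <= j)%N by case/andP: jk.
have [q /eqP/size_poly1P[c c0 ->] E] := P_tilde_poly R 0 0 j2.
by rewrite (E _ (th j jk)) expr0 mul1r hornerC.
Qed.

Lemma de_moivre (x : R) n : (cos x +i* sin x) ^+ n = cos (n%:R * x) +i* sin (n%:R * x).
Proof.
elim: n => [|n IH]; first by rewrite expr0 mul0r cos0 sin0.
rewrite exprS IH -[n.+1%:R]natr1 mulrDl mul1r [n%:R * x + x]addrC cosD sinD.
by rewrite [RHS](_ : _ = (cos x * cos (n%:R * x) - sin x * sin (n%:R * x)) +i* (cos x * sin (n%:R * x) + sin x * cos (n%:R * x))) //; congr (_ +i* _); ring.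
Qed.

(* Induction on k: varying the last degree separates the values of
   cos (theta k.+2); where sin (theta k.+2) = 0 only one point is left, and
   elsewhere the power of the sine can be divided out. *)
Lemma harmonic_poly_separation (I : finType) (theta : I -> nat -> R) k (w : I -> R[i]) :
  (forall i j, (2 <= j < k.+2)%N -> 0 <= theta i j <= pi) ->
  (forall i i', w i != 0 -> w i' != 0 -> same_point k (theta i) (theta i') -> i = i') ->
  (forall g, {homo g : a b / (a <= b)%N} ->
     \sum_i w i * harmonic_poly k g (theta i) = 0) ->
  forall i, w i = 0.
Proof.
elim: k w => [|k IH] w th inj wY i0; apply: contraTeq isT => wi0.
  (* On the circle the harmonics are the powers of e^(i theta_1), so the monomials separate the
     points. *)
  pose x i := cos (theta i 1%N) +i* sin (theta i 1%N).
  have := @poly_separation _ _ (fun n => 'X^n) x w (@size_polyXn _) _ (x i0).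
  rewrite (bigD1 i0) //= big1 ?addr0; last first.
    move=> i /andP[/eqP[xc xs] ii0]; apply: contraNeq ii0 => wi.
    by apply/eqP/inj.
  move=> wi; rewrite wi ?eqxx // in wi0 => n.
  rewrite -[RHS](wY (fun=> n) (fun _ _ _ => leqnn n)); apply: eq_bigr => i _.
  by rewrite hornerXn de_moivre /harmonic_poly /polar_factor big_geq // rmorph1 mulr1.
have thk i : 0 <= theta i k.+2 <= pi by apply: th; rewrite ltnSn.
have th' i j : (2 <= j < k.+2)%N -> 0 <= theta i j <= pi.
  by move=> jk; apply: th; lia.
have grp g : {homo g : a b / (a <= b)%N} ->
   \sum_(i | cos (theta i k.+2) == cos (theta i0 k.+2))
     w i * harmonic_poly k g (theta i) * (sin (theta i k.+2) ^+ g k.+1)%:C = 0.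
  move=> gm.
  have k2 : (2 <= k.+2)%N by [].
  pose q n := sval (cid2 (P_tilde_poly R (g k.+1) n k2)).
  have [sq qE] : (forall n, size (q n) = n.+1) /\ (forall n t, 0 <= t <= pi ->
      P_tilde k.+2 (g k.+1 + n)%N%:Z (g k.+1)%:Z t = sin t ^+ g k.+1 * (q n).[cos t]).
    by split=> n; rewrite /q; case: cid2.
  have := @poly_separation _ _ (fun n => map_poly (real_complex R) (q n))
    (fun i => (cos (theta i k.+2))%:C)
    (fun i => w i * harmonic_poly k g (theta i) * (sin (theta i k.+2) ^+ g k.+1)%:C)
    _ _ (cos (theta i0 k.+2))%:C.
  under eq_bigl do rewrite (inj_eq (@complexI R)).
  apply => n; first by rewrite size_map_poly.
  (* Only the last degree is varied: [g'] keeps the lower ones and stays monotone because it is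
     constant at g(k+1) + n beyond them. *)
  pose g' j := if (j <= k.+1)%N then g j else (g k.+1 + n)%N.
  have gm' : {homo g' : a b / (a <= b)%N}.
    move=> a b ab; rewrite /g'; have gab := gm a b ab.
    have [ak|ak] := leqP a k.+1; have [bk|bk] := leqP b k.+1 => //.
      by apply: (leq_trans (gm _ _ ak)); rewrite leq_addr.
    by lia.
  rewrite -[RHS](wY g' gm'); apply: eq_bigr => i _.
  rewrite horner_map -[LHS]mulrA -rmorphM -qE // harmonic_poly_recr [RHS]mulrA.
  have -> : g' k.+2 = (g k.+1 + n)%N by rewrite /g' ltnn.
  have -> : g' k.+1 = g k.+1 by rewrite /g' leqnn.
  by rewrite (@eq_harmonic_poly _ g' g) // => j jk; rewrite /g' jk.
have cosE i : cos (theta i k.+2) == cos (theta i0 k.+2) -> theta i k.+2 = theta i0 k.+2.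
  by move=> /eqP; apply: cos_inj; rewrite in_itv /= thk.
have [s0|s0] := eqVneq (sin (theta i0 k.+2)) 0.
  (* Degree 0 turns the power of the vanishing sine into [0 ^+ 0 = 1]. *)
  have := grp (fun=> 0%N) (fun _ _ _ => leqnn 0).
  rewrite (bigD1 i0) //= big1 ?addr0; last first.
    move=> i /andP[/cosE ei ii0]; rewrite (_ : w i = 0) ?mul0r //.
    apply: contraNeq ii0 => wi; apply/eqP/inj => //; split=> //; left.
    by rewrite ei.
  rewrite expr0 rmorph1 mulr1 => /eqP; rewrite mulf_eq0 (negbTE wi0) /=.
  by rewrite (negbTE (harmonic_poly0_neq0 (th' i0))).
(* Restricting the weights to the fibre of [i0] makes the last angle common, so points of the
   support are told apart by the lower angles. *)
pose w' i := if cos (theta i k.+2) == cos (theta i0 k.+2) then w i else 0.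
have : w' i0 = 0.
  apply: IH => // [i i'|g gm].
    rewrite /w'; case: ifP => [/cosE ci|]; last by rewrite eqxx.
    case: ifP => [/cosE ci'|]; last by rewrite eqxx.
    by move=> wi wi' sp; apply: inj => //; split; [rewrite ci ci'|right].
  have sC : (sin (theta i0 k.+2) ^+ g k.+1)%:C != 0 :> R[i].
    by rewrite fmorph_eq0 expf_neq0.
  apply: (mulIf sC); rewrite mul0r -[RHS](grp g gm) mulr_suml [RHS]big_mkcond /=.
  apply: eq_bigr => i _; rewrite /w'; case: ifP => [/cosE ->//|_].
  by rewrite !mul0r.
by rewrite /w' eqxx => wi; rewrite wi eqxx in wi0.
Qed.

End Separation.

(** * Existence of polar coordinates and their ambiguity *)

Section PolarCoordinates.
Variable R : realType.
Implicit Types (theta phi : nat -> R) (x : nat -> R).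

(** The entries of [polar_point], indexed by [nat] so that the dimension can vary in inductions. *)
Definition polar_coord d theta (i : nat) : R :=
  match i with
  | 0 => (\prod_(2 <= j < d) sin (theta j)) * cos (theta 1%N)
  | 1 => (\prod_(2 <= j < d) sin (theta j)) * sin (theta 1%N)
  | k.+2 => (\prod_(k.+3 <= j < d) sin (theta j)) * cos (theta k.+2)
  end.

Lemma polar_coord_max m theta : polar_coord m.+3 theta m.+2 = cos (theta m.+2).
Proof. by rewrite /polar_coord big_geq // mul1r. Qed.

Lemma polar_coordS m theta i : (i < m.+2)%N ->
  polar_coord m.+3 theta i = polar_coord m.+2 theta i * sin (theta m.+2).
Proof.
by case: i => [|[|i]] im; rewrite /polar_coord big_nat_recr //= mulrAC.
Qed.

Lemma eq_polar_coord m theta phi i : (i < m.+2)%N ->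
  (forall j, (0 < j < m.+2)%N -> theta j = phi j) ->
  polar_coord m.+2 theta i = polar_coord m.+2 phi i.
Proof.
move=> im E; case: i im => [|[|i]] im; rewrite /polar_coord E ?im //; congr (_ * _);
  by apply: eq_big_nat => j /andP[j2 jm]; rewrite E // jm andbT; lia.
Qed.

(** A vanishing sine annihilates all lower coordinates, whatever the lower angles are. *)
Lemma same_point_coord k theta phi : same_point k theta phi ->
  forall i, (i < k.+2)%N -> polar_coord k.+2 theta i = polar_coord k.+2 phi i.
Proof.
elim: k => [[c s] [|[|i]] //= _|k IH [e sp] i].
- by rewrite !big_geq // c.
- by rewrite !big_geq // s.
rewrite ltnS leq_eqVlt => /orP[/eqP -> |ik]; first by rewrite !polar_coord_max e.
rewrite !polar_coordS // -e; case: sp => [->|sp]; first by rewrite !mulr0.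
by rewrite (IH sp).
Qed.

Lemma circle_angle (x y r : R) : 0 <= r -> x ^+ 2 + y ^+ 2 = r ^+ 2 ->
  exists2 t : R, 0 <= t < 2 * pi & x = r * cos t /\ y = r * sin t.
Proof.
have pi0 := pi_gt0 R.
rewrite le_eqVlt => /orP[/eqP <-|r0] E.
  exists 0; first by rewrite lexx mulr_gt0.
  rewrite !mul0r; rewrite expr0n /= in E.
  have x2 := sqr_ge0 x; have y2 := sqr_ge0 y.
  by split; apply/eqP; rewrite -sqrf_eq0; apply/eqP; lra.
have rn : r != 0 by rewrite gt_eqF.
have E1 : (x / r) ^+ 2 + (y / r) ^+ 2 = 1.
  by rewrite !expr_div_n -mulrDl E divff // expf_neq0.
have xr : -1 <= x / r <= 1.
  have y2 := sqr_ge0 (y / r); rewrite -ler_norml -(@ler_pXn2r _ 2) ?nnegrE //.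
  by rewrite expr1n -normrX ger0_norm ?sqr_ge0 //; lra.
have [/andP[a0 api] ca] := acos_def xr.
have sa : sin (acos (x / r)) = `|y / r|.
  by rewrite sin_acos // -sqrtr_sqr; congr Num.sqrt; lra.
have [y0|y0] := leP 0 y.
  exists (acos (x / r)); first by rewrite a0; lra.
  by rewrite ca sa ger0_norm ?divr_ge0 ?(ltW r0) // ![r * _]mulrC !divfK.
have yr : y / r < 0 by rewrite pmulr_llt0 // invr_gt0.
(* Needed for the reflected angle 2 pi - acos(x/r) to stay strictly below 2 pi. *)
have an0 : acos (x / r) != 0.
  apply/eqP => a00; move: sa; rewrite a00 sin0 => /esym/eqP; rewrite normr_eq0.
  by rewrite lt_eqF.
exists (2 * pi - acos (x / r)).
  have : 0 < acos (x / r) by rewrite lt_neqAle eq_sym an0.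
  by move=> ?; apply/andP; split; lra.
have per : 2 * pi - acos (x / r) = - acos (x / r) + pi *+ 2 by rewrite mulr2n; lra.
rewrite per cosD2pi sinD2pi cosN sinN ca sa ltr0_norm // opprK.
by rewrite ![r * _]mulrC !divfK.
Qed.

(** Induction on the dimension: the norm rho of the first m + 2 coordinates is the radius one
    dimension lower, and (x_(m+2), rho) lies on the circle of radius r. As rho >= 0, its angle can
    be taken in [0, pi]. *)
Lemma polar_coord_exists m x (r : R) : 0 <= r ->
  \sum_(i < m.+2) x i ^+ 2 = r ^+ 2 ->
  exists theta, [/\ 0 <= theta 1%N < 2 * pi,
    forall j, (2 <= j < m.+2)%N -> 0 <= theta j <= pi &
    forall i, (i < m.+2)%N -> x i = r * polar_coord m.+2 theta i].
Proof.
elim: m x r => [|m IH] x r r0.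
  rewrite !big_ord_recl big_ord0 addr0 /= => E.
  have [t t0 [xE yE]] := circle_angle r0 E.
  exists (fun=> t); split=> // [[|[]] //|[|[|]] //= _]; by rewrite big_geq // mul1r.
rewrite big_ord_recr /= => E.
pose rho := Num.sqrt (\sum_(i < m.+2) x i ^+ 2).
have S0 : 0 <= \sum_(i < m.+2) x i ^+ 2 by apply: sumr_ge0 => i _; exact: sqr_ge0.
have [|theta [th1 th thE]] := IH x rho (sqrtr_ge0 _); first by rewrite sqr_sqrtr.
have E' : x m.+2 ^+ 2 + rho ^+ 2 = r ^+ 2 by rewrite sqr_sqrtr // addrC.
have [t t01 [xE rE]] := circle_angle r0 E'.
have [a a0 [ca sa]] : exists2 a : R, 0 <= a <= pi & x m.+2 = r * cos a /\ rho = r * sin a.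
  have [rz|rn] := eqVneq r 0.
    by exists 0; [rewrite lexx pi_ge0 | rewrite xE rE rz !mul0r].
  exists t => //; case/andP: t01 => t0 t2; rewrite t0 /= leNgt; apply/negP => pit.
  have rp : 0 < r by rewrite lt_neqAle eq_sym rn.
  have : 0 < sin (t - pi) by apply: sin_gt0_pi; apply/andP; split; lra.
  rewrite sinB cospi sinpi mulr0 subr0 mulrN1 oppr_gt0 => st.
  have : rho < 0 by rewrite rE pmulr_rlt0.
  by rewrite ltNge sqrtr_ge0.
exists (fun j => if j == m.+2 then a else theta j); split.
- exact: th1.
- by move=> j /andP[j2 jm]; case: eqP => // /eqP jn; apply: th; lia.
move=> i; rewrite ltnS leq_eqVlt => /orP[/eqP ->|im].
  by rewrite polar_coord_max eqxx.
rewrite polar_coordS // eqxx thE // sa mulrAC -mulrA; congr (_ * (_ * _)).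
by apply: eq_polar_coord => // j /andP[_ jm]; rewrite ltn_eqF.
Qed.

Lemma polar_pointE d (theta : nat -> R) (i : 'I_d) :
  polar_point d theta 0 i = polar_coord d theta i.
Proof. by rewrite mxE. Qed.

Lemma angles_ofP d (xi : 'rV[R]_d) : (2 <= d)%N -> sphere xi ->
  polar_angles d (angles_of xi) /\ polar_point d (angles_of xi) = xi.
Proof.
case: d xi => [|[|m]] // xi _ xi1.
have : \sum_(i < m.+2) xi 0 (inord i) ^+ 2 = 1 ^+ 2.
  by rewrite expr1n -[RHS]xi1; apply: eq_bigr => i _; rewrite inord_val.
move=> /(@polar_coord_exists _ (fun i => xi 0 (inord i)) 1 ler01)[theta [th1 th thE]].
apply: (@getPex _ [set theta | polar_angles m.+2 theta /\ polar_point m.+2 theta = xi]).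
exists theta; split; first by split.
apply/rowP => i; rewrite polar_pointE -[LHS]mul1r -thE // inord_val.
by [].
Qed.

End PolarCoordinates.

(** * Hermitian forms bounded below by eigenvalues *)

Section HermitianForms.
Variable C : numClosedFieldType.

Lemma conjmxM m n p (A : 'M[C]_(m, n)) (B : 'M[C]_(n, p)) :
  (A *m B) ^t* = B ^t* *m A ^t*.
Proof. by rewrite trmx_mul map_mxM. Qed.

Lemma hermform_diag n (s : 'rV[C]_n) (w : 'cV[C]_n) :
  (w ^t* *m diag_mx s *m w) 0 0 = \sum_j s 0 j * `|w j 0| ^+ 2.
Proof.
rewrite mul_mx_diag mxE; apply: eq_bigr => j _.
by rewrite !mxE normCK; ring.
Qed.

Lemma hermsymmx_conj n (A : 'M[C]_n) : (A \is hermsymmx) = (A == A ^t*).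
Proof.
by apply/is_hermitianmxP/eqP; rewrite expr0 scale1r.
Qed.

(** By the spectral theorem the form is diagonal in the coordinates P w, its diagonal entries are
    eigenvalues with the rows of P as eigenvectors, and the unitary P preserves the sum of
    squares. *)
Lemma hermform_lower_bound n (B : 'M[C]_n) (lam : C) :
  B \is hermsymmx -> (forall mu, eigenvalue B mu -> lam <= mu) ->
  forall w : 'cV[C]_n, lam * \sum_j `|w j 0| ^+ 2 <= (w ^t* *m B *m w) 0 0.
Proof.
move=> hB lamP w; have /orthomx_spectralP := hermitian_normalmx hB.
set P := spectralmx B; set s := spectral_diag B => BE.
have uP : P \is unitarymx by exact: spectral_unitarymx.
have Pu : P \in unitmx by exact: unitarymx_unit.
have wE : w = P ^t* *m (P *m w) by rewrite -invmx_unitary // mulKmx.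
have -> : \sum_j `|w j 0| ^+ 2 = \sum_j `|(P *m w) j 0| ^+ 2.
  have E (v : 'cV[C]_n) : \sum_j `|v j 0| ^+ 2 = (v ^t* *m v) 0 0.
    by rewrite mxE; apply: eq_bigr => j _; rewrite !mxE normCK mulrC.
  by rewrite !E conjmxM mulmxA -[_ *m P]mulmxA -invmx_unitary // mulVmx // mulmx1.
have -> : w ^t* *m B *m w = (P *m w) ^t* *m diag_mx s *m (P *m w).
  by rewrite {1}BE conjmxM -invmx_unitary // !mulmxA.
rewrite hermform_diag mulr_sumr; apply: ler_sum => j _.
apply: ler_wpM2r; first by rewrite exprn_ge0.
apply: lamP; apply/eigenvalueP; exists (row j P).
  rewrite BE !mulmxA -row_mul mulmxV // -row_mul mul1mx -row_mul mul_diag_mx.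
  by apply/rowP => i; rewrite !mxE.
apply: contraTneq Pu => rj; rewrite -row_free_unit; apply/row_freePn.
by exists j; rewrite rj sub0mx.
Qed.

End HermitianForms.

Section ScaledBound.
Variable R : realType.

(* Row eigenvectors v of sqrt D A sqrt D give the row eigenvectors
   v sqrt D of A D, with the same eigenvalue. *)
Lemma scaled_hermform_lower_bound k (A : 'M[R[i]]_k) (dj : nat -> R) (lam : R) :
  A \is hermsymmx -> (forall j, 0 < dj j) ->
  is_lambda_min (A *m scale_mx dj k) lam ->
  forall u : 'cV[R[i]]_k,
    lam%:C * \sum_(j < k) `|u j 0| ^+ 2 / (dj j)%:C <= (u ^t* *m A *m u) 0 0.
Proof.
move=> hA dj0 [_ lamP] u.
pose r j : R[i] := (Num.sqrt (dj j))%:C.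
have r0 j : r j != 0 by rewrite fmorph_eq0 sqrtr_eq0 -ltNge.
have rr j : r j * r j = (dj j)%:C.
  by rewrite -rmorphM -expr2 sqr_sqrtr // ltW.
have rc j : Num.conj (r j) = r j by exact: conjc_real.
pose S : 'M[R[i]]_k := diag_mx (\row_(j < k) r j).
have Sc : S ^t* = S.
  rewrite tr_diag_mx map_diag_mx; congr diag_mx; apply/rowP => j; rewrite !mxE; exact: rc.
have SS : S *m S = scale_mx dj k.
  rewrite /scale_mx mul_diag_mx; apply/matrixP => i j; rewrite !mxE.
  by case: eqP => [->|_]; rewrite ?mulr1n ?mulr0n ?mulr0 // rr.
pose B := S *m A *m S.
have hB : B \is hermsymmx.
  move: hA; rewrite !hermsymmx_conj => /eqP hA; apply/eqP.
  by rewrite /B !conjmxM Sc -hA mulmxA.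
have lamB mu : eigenvalue B mu -> lam%:C <= mu.
  move=> /eigenvalueP[v vB v0]; apply: lamP; apply/eigenvalueP; exists (v *m S).
    by rewrite -SS scalemxAl -vB /B !mulmxA.
  apply: contra_neq v0 => vS; apply/rowP => j.
  have /rowP/(_ j) := vS; rewrite mul_mx_diag !mxE => /eqP.
  by rewrite mulf_eq0 (negbTE (r0 _)) orbF => /eqP.
(* The substitution u = S w turns the form of B at w into that of A at u, and |w_j|^2 into |u_j|^2 /
   d_j. *)
pose w : 'cV[R[i]]_k := \col_j (u j 0 / r j).
have Sw : S *m w = u.
  by rewrite mul_diag_mx; apply/colP => j; rewrite !mxE mulrC divfK.
have := hermform_lower_bound hB lamB w.
have -> : w ^t* *m B *m w = u ^t* *m A *m u by rewrite -Sw conjmxM Sc !mulmxA.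
congr (_ * _ <= _); apply: eq_bigr => j _.
have -> : `|w j 0| ^+ 2 = w j 0 * (Num.conj (u j 0) / r j).
  rewrite normCK mxE rmorphM fmorphV; congr (_ * (_ / _)); exact: rc.
by rewrite mxE normCK -rr invfM; ring.
Qed.

End ScaledBound.

(** * Unconditional sums of complex families *)

Section UnconditionalSums.
Variables (R : realType) (I : choiceType) (P : pred I).
Implicit Types (f : I -> R[i]) (s : R[i]).

Lemma gt0_real_complex (z : R[i]) : 0 < z -> exists2 r : R, 0 < r & z = r%:C.
Proof.
rewrite ltcE => /andP[/eqP zi zr]; exists (complex.Re z) => //.
by case: z zi zr => a b /= -> _.
Qed.

Lemma has_sum0 : has_sum P (fun=> 0) (0 : R[i]).
Proof. by move=> e e0; exists fset0 => F _; rewrite big1 // subr0 normr0 ltcR. Qed.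

Lemma has_sumD f1 f2 s1 s2 : has_sum P f1 s1 -> has_sum P f2 s2 ->
  has_sum P (fun i => f1 i + f2 i) (s1 + s2).
Proof.
move=> h1 h2 e e0; have e2 : 0 < e / 2 by rewrite divr_gt0.
have [F1 H1] := h1 _ e2; have [F2 H2] := h2 _ e2.
exists (F1 `|` F2)%fset => F F12.
have h1F := H1 F (fsubset_trans (fsubsetUl _ _) F12).
have h2F := H2 F (fsubset_trans (fsubsetUr _ _) F12).
rewrite big_split /= opprD addrACA (le_lt_trans (ler_normD _ _)) //.
have -> : e%:C = (e / 2)%:C + (e / 2)%:C by rewrite -rmorphD -splitr.
exact: ltrD.
Qed.

Lemma has_sumZ f s (a : R[i]) : has_sum P f s -> has_sum P (fun i => a * f i) (a * s).
Proof.
move=> h; have [->|a0] := eqVneq a 0.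
  by move=> e e0; exists fset0 => F _; rewrite big1 ?mul0r ?subr0 ?normr0 ?ltcR // => i; rewrite mul0r.
have [r r0 ar] : exists2 r : R, 0 < r & `|a| = r%:C.
  by apply: gt0_real_complex; rewrite normr_gt0.
move=> e e0; have [F0 H] := h (e / r) (divr_gt0 e0 r0).
exists F0 => F /H; rewrite -mulr_sumr -mulrBr normrM ar => lt.
have -> : e%:C = r%:C * (e / r)%:C by rewrite -rmorphM mulrC divfK ?gt_eqF.
by rewrite ltr_pM2l // ltcR.
Qed.

Lemma has_sum_sum (J : Type) (js : seq J) (f : J -> I -> R[i]) (s : J -> R[i]) :
  (forall j, has_sum P (f j) (s j)) ->
  has_sum P (fun i => \sum_(j <- js) f j i) (\sum_(j <- js) s j).
Proof.
move=> h; elim: js => [|j js IH].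
  rewrite big_nil (_ : (fun _ => _) = fun=> 0); first exact: has_sum0.
  by apply/funext => i; rewrite big_nil.
rewrite big_cons (_ : (fun _ => _) = fun i => f j i + \sum_(j <- js) f j i).
  exact: has_sumD.
by apply/funext => i; rewrite big_cons.
Qed.

(** A cofinal family of finite sets is enough: their sums are real, at least r, and come arbitrarily
    close to s. Precision |Im s| would contradict Im s != 0, and precision r gives Re s > 0. *)
Lemma has_sum_gt0 f s (r : R) : 0 < r -> has_sum P f s ->
  (forall F0 : {fset I}, exists2 F : {fset I}, (F0 `<=` F)%fset &
     r%:C <= \sum_(i <- F | P i) f i) ->
  0 < s.
Proof.
move=> r0 hs large.
have appr (e : R) : 0 < e -> exists2 z : R[i], r%:C <= z & `|s - z| < e%:C.
  move=> /hs[F0 H]; have [F F0F rF] := large F0.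
  by exists (\sum_(i <- F | P i) f i) => //; exact: H.
have ReIm (z w : R[i]) (e : R) : r%:C <= w -> `|z - w| < e%:C ->
    r - e < complex.Re z /\ `|complex.Im z| < e.
  case: z w => a b [a' b']; rewrite lecE /= => /andP[/eqP -> ra'].
  rewrite normc_def /= subr0 ltcR => lt.
  have x2 := sqr_ge0 (a - a'); have y2 := sqr_ge0 b.
  have n1 : `|a - a'| < e.
    by apply: le_lt_trans lt; rewrite -sqrtr_sqr ler_sqrt ?addr_ge0 // lerDl.
  have n2 : `|b| < e.
    by apply: le_lt_trans lt; rewrite -sqrtr_sqr ler_sqrt ?addr_ge0 // lerDr.
  by split=> //; move: n1; rewrite ltr_norml => /andP[? ?]; lra.
have Im0 : complex.Im s = 0.
  apply/eqP/negP => /negP s0.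
  have [|z rz sz] := appr `|complex.Im s|; first by rewrite normr_gt0.
  by have [_] := ReIm _ _ _ rz sz; rewrite ltxx.
have [z rz sz] := appr _ r0.
have [re _] := ReIm _ _ _ rz sz.
by rewrite ltcE Im0 eqxx /=; move: re; rewrite subrr.
Qed.

End UnconditionalSums.

(** * The spherical harmonics at distinct points of the sphere *)

Section Harmonics.
Variables (R : realType) (k : nat).
Implicit Types g : nat -> nat.

(** The shift by 2 reflects that l_2 is stored at position 0; l_1 = [g 1] is kept apart. *)
Definition degrees g : multidx k.+2 := [tuple (g i.+2)%:Z | i < k].

Lemma nth_degrees g i : (i <= k)%N ->
  nth 0 ((g 1%N)%:Z :: degrees g) i = (g i.+1)%:Z.
Proof.
case: i => [//|i] ik.
by rewrite -[nth _ _ _]/(nth 0 (degrees g) i) -(tnth_nth 0 _ (Ordinal ik)) tnth_mktuple.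
Qed.

Lemma degrees_Lambda g : {homo g : a b / (a <= b)%N} -> Lambda (g 1%N)%:Z (degrees g).
Proof.
move=> gm; rewrite /Lambda; apply/(pathP 0) => i; rewrite size_tuple => ik.
rewrite nth_degrees ?(ltnW ik) //.
have -> : nth 0 (degrees g) i = (g i.+2)%:Z by rewrite -(nth_degrees g ik).
by rewrite lez_nat; apply: gm.
Qed.

Lemma Y_harmonic_poly g (xi : 'rV[R]_k.+2) :
  Y (g 1%N)%:Z (degrees g) xi =
  (Num.sqrt (2 * pi))^-1%:C * harmonic_poly k g (angles_of xi).
Proof.
rewrite /Y /Y_polar /harmonic_poly mulrA -!pmulrn.
have -> : polar_factor k g (angles_of xi) =
  \prod_(2 <= j < k.+2) P_tilde j (deg_at (g 1%N)%:Z (degrees g) j)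
     (deg_at (g 1%N)%:Z (degrees g) j.-1) (angles_of xi j).
  rewrite /polar_factor; apply: eq_big_nat => j /andP[j2 jk].
  have E i : (0 < i < k.+2)%N -> deg_at (g 1%N)%:Z (degrees g) i = (g i)%:Z.
    by case: i => // i ik; exact: nth_degrees.
  have j1 : (0 < j < k.+2)%N by rewrite jk andbT (ltnW j2).
  have j1' : (0 < j.-1 < k.+2)%N by lia.
  by rewrite (E _ j1) (E _ j1').
by [].
Qed.

(** At monotone degree sequences [Y] is a nonzero multiple of [harmonic_poly], and points with
    equivalent polar angles coincide, so separation by angles applies. *)
Lemma Y_separation n (x : 'I_n -> 'rV[R]_k.+2) (w : 'I_n -> R[i]) :
  injective x -> (forall i, sphere (x i)) ->
  (forall l1 l, Lambda l1 l -> \sum_i w i * Y l1 l (x i) = 0) ->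
  forall i, w i = 0.
Proof.
move=> xinj xS wY.
have ang i := angles_ofP (isT : (2 <= k.+2)%N) (xS i).
apply: (@harmonic_poly_separation R _ (fun i => angles_of (x i)) k).
- by move=> i j; have [[_ h] _] := ang i; exact: h.
- move=> i i' _ _ /same_point_coord sp; apply: xinj.
  rewrite -(ang i).2 -(ang i').2; apply/rowP => j.
  by rewrite !polar_pointE; exact: sp.
move=> g gm; have := wY _ _ (degrees_Lambda gm).
have c0 : (Num.sqrt (2 * pi))^-1%:C != 0 :> R[i].
  by rewrite fmorph_eq0 invr_neq0 // gt_eqF // sqrtr_gt0 mulr_gt0 // pi_gt0.
move=> E; apply: (mulfI c0); rewrite mulr0 -[RHS]E mulr_sumr; apply: eq_bigr => i _.
by rewrite Y_harmonic_poly mulrCA.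
Qed.

End Harmonics.

(** * Exhaustion of the index set by finite square blocks *)

Lemma cover_blocks (R : realType) d (e : int -> nat -> multidx d)
    (e_enum : forall m, degree_enum m (e m)) (F0 : {fset term_idx d}) m0 a0 :
  exists (M : seq int) (k : nat) (F : {fset term_idx d}),
    [/\ uniq M, m0 \in M, (a0 < k)%N, (F0 `<=` F)%fset &
        forall f : term_idx d -> R[i], \sum_(t <- F | valid_idx t) f t =
          \sum_(m <- M) \sum_(a < k) \sum_(b < k) f (m, e m a, e m b)].
Proof.
(* [idx m] inverts the enumeration on [Lambda m]; the default 0 elsewhere is harmless in the maximum
   defining [k]. *)
pose idx m l := xget 0%N [set a | e m a = l].
have idxP m l : Lambda m l -> e m (idx m l) = l.
  move=> ml; have [[_ _ /(_ l ml)[a _ ea]] _] := e_enum m.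
  by apply: (@xgetPex _ 0%N [set a | e m a = l]); exists a.
have einj m : injective (e m).
  by have [[_ /in2TT inj _] _] := e_enum m.
have eL m a : Lambda m (e m a).
  by have [[h _ _] _] := e_enum m; exact: h.
pose M := undup (m0 :: [seq t.1.1 | t <- F0]).
pose k := (maxn a0 (\max_(t <- F0) maxn (idx t.1.1 t.1.2) (idx t.1.1 t.2))).+1.
pose blk (p : int * ('I_k * 'I_k)) : term_idx d := (p.1, e p.1 p.2.1, e p.1 p.2.2).
have blk_inj : injective blk.
  move=> [m [a b]] [m' [a' b']] [] <- /einj/val_inj <- /einj/val_inj <-.
  by [].
pose s := [seq blk p | p <- allpairs pair M (enum {: 'I_k * 'I_k})].
have us : uniq s.
  by rewrite map_inj_uniq // allpairs_uniq ?undup_uniq ?enum_uniq // => -[? ?] [].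
(* Every valid triple of [F0] already lies in a block listed by [s]; the invalid ones remain in [F]
   but are filtered out of the sum. *)
exists M, k, (F0 `|` [fset t in s])%fset; split.
- exact: undup_uniq.
- by rewrite mem_undup inE eqxx.
- by rewrite ltnS leq_maxl.
- exact: fsubsetUl.
move=> f; rewrite -big_filter (@perm_big _ _ _ _ _ s); last first.
  apply: uniq_perm => //; first by rewrite filter_uniq // fset_uniq.
  move=> t; rewrite mem_filter in_fsetU in_fset /=.
  apply/idP/idP => [/andP[/andP[v1 v2] /orP[tF|//]]|ts]; last first.
    rewrite ts orbT andbT; case/mapP: ts => p _ ->.
    by rewrite /valid_idx /= !eL.
  have tk : (maxn (idx t.1.1 t.1.2) (idx t.1.1 t.2) < k)%N.
    rewrite ltnS leq_max; apply/orP; right.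
    exact: (leq_bigmax_seq (F := fun t : term_idx d => maxn (idx t.1.1 t.1.2) (idx t.1.1 t.2))).
  move: tk; rewrite gtn_max => /andP[k1 k2].
  apply/mapP; exists (t.1.1, (Ordinal k1, Ordinal k2)).
    apply/allpairsP; exists (t.1.1, (Ordinal k1, Ordinal k2)); split => //=.
      rewrite mem_undup inE; apply/orP; right.
      exact: (map_f (fun t : term_idx d => t.1.1) tF).
    by rewrite mem_enum.
  by rewrite /blk /= !idxP //; case: t {tF k1 k2 v1 v2} => [[]].
rewrite big_map big_allpairs; apply: eq_bigr => m _.
rewrite pair_big /= big_enum /=.
by apply: eq_bigr.
Qed.

(** * Positivity of the quadratic form of the kernel *)

Lemma hermformE (C : numClosedFieldType) n (A : 'M[C]_n) (u : 'cV[C]_n) :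
  (u ^t* *m A *m u) 0 0 = \sum_a \sum_b Num.conj (u a 0) * A a b * u b 0.
Proof.
rewrite exchange_big mxE; apply: eq_bigr => b _; rewrite mxE mulr_suml.
by apply: eq_bigr => a _; rewrite !mxE.
Qed.

Lemma posdefmx_ge0 (R : realType) n (A : 'M[R[i]]_n) (u : 'cV[R[i]]_n) :
  posdefmx A -> 0 <= (u ^t* *m A *m u) 0 0.
Proof.
move=> [_ A0]; have [->|u0] := eqVneq u 0; first by rewrite mulmx0 mxE.
exact/ltW/A0.
Qed.

Theorem lemma7 (R : realType) (d : nat) (d_ge3 : (3 <= d)%N)
    (K : 'rV[R]_d -> 'rV[R]_d -> R[i])
    (c : int -> multidx d -> multidx d -> R[i])
    (e : int -> nat -> multidx d)
    (K_herm : hermitian_kernel (@sphere R d) K)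
    (K_axial : axially_symmetric K)
    (K_exp : kernel_expansion c K)
    (c_sum : coef_summable c)
    (e_enum : forall l1 : int, degree_enum l1 (e l1))
    (A_posdef : forall (l1 : int) (k : nat), (1 <= k)%N ->
       posdefmx (coef_mx (c l1) (e l1) k))
    (A_lambda : forall l1 : int, exists (dj : nat -> R) (eps : R),
       [/\ forall j : nat, 0 < dj j,
           0 < eps &
           forall k : nat, (1 <= k)%N ->
             exists2 lam : R,
               is_lambda_min (coef_mx (c l1) (e l1) k *m scale_mx dj k) lam
               & eps < lam]) :
  strictly_posdef_kernel (@sphere R d) K.
Proof.
case: d d_ge3 K c e K_herm K_axial K_exp c_sum e_enum A_posdef A_lambda
  => [|[|k]] // _ K c e K_herm _ K_exp _ e_enum A_posdef A_lambda n x xinj xS.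
split.
  by rewrite hermsymmx_conj; apply/eqP/matrixP => i j; rewrite !mxE; exact: K_herm.
move=> v v0; pose w i := Num.conj (v i 0).
pose y l1 l := \sum_i w i * Y l1 l (x i).
have [l1 [l [ml yl]]] : exists l1 l, Lambda l1 l /\ y l1 l != 0.
  apply: contrapT => H; move/eqP: v0; apply; apply/colP => i; rewrite mxE.
  apply/eqP; rewrite -(fmorph_eq0 Num.conj); apply/eqP.
  apply: (@Y_separation _ _ _ x w) => // l1 l ml.
  by apply: contrapT => yl; apply: H; exists l1, l; split=> //; apply/eqP.
have yC m l' : Num.conj (y m l') = \sum_j v j 0 * Num.conj (Y m l' (x j)).
  by rewrite rmorph_sum; apply: eq_bigr => j _; rewrite rmorphM /= conjCK.
have [a0 ea0] : exists a, e l1 a = l.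
  by have [[_ _ /(_ l ml)[a _ <-]] _] := e_enum l1; exists a.
have [dj [eps [dj0 eps0 lamP]]] := A_lambda l1.
have [r r0 rE] : exists2 r : R, 0 < r & `|y l1 l| ^+ 2 = r%:C.
  by apply: gt0_real_complex; rewrite exprn_gt0 // normr_gt0.
pose term (t : term_idx k.+2) :=
  c t.1.1 t.1.2 t.2 * y t.1.1 t.1.2 * Num.conj (y t.1.1 t.2).
(* The lower bound is the contribution of the single entry [a0] of block [l1], where |y|^2 = r > 0;
   it is the same for all finite sections. *)
apply: (@has_sum_gt0 _ _ (@valid_idx k.+2) term _ (eps * (r / dj a0))).
- by rewrite mulr_gt0 // divr_gt0.
(* The quadratic form is a finite combination of values of K, so its expansion is obtained by
   combining theirs term by term. *)
- pose a (p : 'I_n * 'I_n) := w p.1 * v p.2 0.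
  have := has_sum_sum (index_enum (('I_n * 'I_n)%type : finType))
    (fun p => has_sumZ (a p) (K_exp _ _ (xS p.1) (xS p.2))).
  congr has_sum.
    apply/funext => t; rewrite /term yC {1}/y.
    rewrite -(pair_bigA _ (fun i j => a (i, j) *
      (c t.1.1 t.1.2 t.2 * Y t.1.1 t.1.2 (x i) * Num.conj (Y t.1.1 t.2 (x j))))) /=.
    rewrite [c _ _ _ * \sum_i _]mulr_sumr mulr_suml; apply: eq_bigr => i _.
    by rewrite mulr_sumr; apply: eq_bigr => j _; rewrite /a /=; ring.
  rewrite hermformE -(pair_bigA _ (fun i j => a (i, j) * K (x i) (x j))) /=.
  by apply: eq_bigr => i _; apply: eq_bigr => j _; rewrite mxE /a /w; ring.
move=> F0; have [M [N [F [uM l1M a0N F0F FE]]]] := cover_blocks R e_enum F0 l1 a0.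
exists F => //; rewrite FE.
have N1 : (1 <= N)%N by apply: leq_ltn_trans a0N.
(* The conjugate is taken because the form conjugates its left argument, whereas [term] conjugates
   the right factor y. *)
pose u m : 'cV[R[i]]_N := \col_b Num.conj (y m (e m b)).
have blockE m : \sum_(a < N) \sum_(b < N) term (m, e m a, e m b) =
    ((u m) ^t* *m coef_mx (c m) (e m) N *m u m) 0 0.
  rewrite hermformE; apply: eq_bigr => a _; apply: eq_bigr => b _.
  by rewrite !mxE /term /= conjCK; ring.
(* All blocks other than [l1] are nonnegative and are bounded below by 0. *)
rewrite (bigD1_seq l1) //= -[leLHS]addr0; apply: lerD; last first.
  by apply: sumr_ge0 => m _; rewrite blockE posdefmx_ge0 //; exact: A_posdef.
have [lam lamA eps_lam] := lamP N N1.
rewrite blockE.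
apply: le_trans (scaled_hermform_lower_bound (A_posdef l1 N N1).1 dj0 lamA (u l1)).
have t0 (b : 'I_N) : 0 <= `|u l1 b 0| ^+ 2 / (dj b)%:C.
  by rewrite divr_ge0 ?exprn_ge0 // ler0c ltW.
rewrite rmorphM; apply: ler_pM.
- by rewrite ler0c ltW.
- by rewrite ler0c ltW // divr_gt0.
- by rewrite lecR ltW.
(* Within block [l1] only the entry [a0] is retained. *)
rewrite (bigD1 (Ordinal a0N)) //= -[leLHS]addr0; apply: lerD; last exact: sumr_ge0.
by rewrite mxE /= ea0 norm_conjC rE rmorphM fmorphV.
Qed.
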